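(* Let $\mathcal{H}$ be a separable Hilbert space with orthonormal basis $\{e_i\}_{i\in\mathbb{Z}}$, let $\mathcal{A}=B_0(\mathcal{H})$ be the $C^*$-algebra of compact operators on $\mathcal{H}$, let $W=(W_j)_{j\in\mathbb{Z}}$ be a uniformly bounded sequence of invertible operators in $B(\mathcal{H})$ such that $(W_j^{-1})_{j\in\mathbb{Z}}$ is also uniformly bounded, and let $T_W$ be the operator on $\ell_2(\mathcal{A})$ given by $(T_W(x))_n=W_nx_{n-1}$ for $n\in\mathbb{Z}$. The following assertions are equivalent. (1) $T_W$ is chaotic. (2) $T_W$ satisfies the Frequent Hypercyclicity Criterion. (3) For every $J,m\in\mathbb{N}$ there exist a strictly increasing sequence $\{n_k\}_k\subset\mathbb{N}$ and, for each $i\in[J]$, a sequence $\{D^{(k)}_i\}_k$ of operators in $B_0(\mathcal{H})$ such that for all $j\in[J]$ $$\lim_{k\to\infty}\|D^{(k)}_j-P_m\|=0$$ and (i) $\sum_{l=1}^{\infty}{D^{(k)}_j}^{*}W_{j+1}^{*}\cdots W_{j+ln_k}^{*}W_{j+ln_k}\cdots W_{j+1}D^{(k)}_j$ converges for all $k\in\mathbb{N}$ and $j\in[J]$, (ii) $\sum_{l=1}^{\infty}{D^{(k)}_j}^{*}(W_{j}^{-1})^{*}\cdots (W_{j-ln_k+1}^{-1})^{*}W_{j-ln_k+1}^{-1}\cdots W_{j}^{-1}D^{(k)}_j$ converges for all $k\in\mathbb{N}$ and $j\in[J]$. In particular, if $T_W$ is chaotic, then it is frequently hypercyclic and topologically 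mixing.
   Context: $B(\mathcal{H})$ is the $C^*$-algebra of bounded linear operators on $\mathcal{H}$. $\ell_2(\mathcal{A})$ is the standard right Hilbert $\mathcal{A}$-module of sequences $x=(x_j)_{j\in\mathbb{Z}}$ in $\mathcal{A}$ such that $\sum_{j}x_j^*x_j$ converges in norm in $\mathcal{A}$, with inner product $\langle x,y\rangle=\sum_j x_j^*y_j$ and norm $\|x\|=\|\langle x,x\rangle\|^{1/2}$. For $J,m\in\mathbb{N}$, $[J]=\{-J,-J+1,\dots,J\}$, $L_m=\mathrm{span}\{e_{-m},e_{-m+1},\dots,e_m\}$, and $P_m$ is the orthogonal projection of $\mathcal{H}$ onto $L_m$. Convergence of the operator series in (3) is in the norm of $\mathcal{A}$. Let $T$ be a continuous linear operator on a separable Banach space $X$. $T$ is hypercyclic if some $x\in X$ has dense orbit $\{T^nx:n\in\mathbb{N}_0\}$, where $\mathbb{N}_0=\mathbb{N}\cup\{0\}$; it is chaotic if it is hypercyclic and has a dense set of periodic points. $T$ is frequently hypercyclic if there is $x\in X$ such that for every non-empty open $O\subset X$ the set $N(x,O)=\{n\in\mathbb{N}_0:T^nx\in O\}$ has positive lower density $\liminf_{n\to\infty}\frac{\#(N(x,O)\cap[0,n])}{n+1}>0$. $T$ is topologically mixing if for all non-empty open $O,V\subset X$ the set $\{n\in\mathbb{N}_0:T^n(O)\cap V\neq\emptyset\}$ is cofinite. $T$ satisfies the Frequent Hypercyclicity Criterion if there are a dense subset $X_0$ of $X$ and a map $S:X_0\to X_0$ such that for every $x\in X_0$: $\sum_{n=0}^\infty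 T^nx$ converges unconditionally, $\sum_{n=0}^\infty S^nx$ converges unconditionally, and $TSx=x$. *)

(* Defs.v *)
From HB Require Import structures.
From mathcomp Require Import all_boot all_order all_algebra finmap.
From mathcomp Require Import complex ring lra.
From mathcomp Require Import all_classical all_reals all_analysis.
From mathcomp.analysis.showcase Require Import summability.
Set Implicit Arguments.
Unset Strict Implicit.
Unset Printing Implicit Defensive.
Import Order.TTheory GRing.Theory Num.Theory numFieldNormedType.Exports.
Local Open Scope classical_set_scope.
Local Open Scope ring_scope.
Local Open Scope complex_scope.

(* Over the scalars R[i], the library norm takes its values in R[i]; [rnorm] is
   the same norm read in R. *)
Definition rnorm (R : realType) (V : normedModType R[i]) (x : V) : R :=
  complex.Re `|x|.

Section RealNorm.
Variables (R : realType) (V : normedModType R[i]).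
Implicit Types x y : V.

Lemma rnormE x : `|x| = (rnorm x)%:C.
Proof. by rewrite /rnorm RRe_real// normr_real. Qed.

Lemma rnorm_ge0 x : 0 <= rnorm x.
Proof. by have := normr_ge0 x; rewrite rnormE lecR. Qed.

Lemma rnorm_le x (c : R) : (rnorm x <= c) = (`|x| <= c%:C).
Proof. by rewrite rnormE lecR. Qed.
Lemma rnorm_lt x (c : R) : (rnorm x < c) = (`|x| < c%:C).
Proof. by rewrite rnormE ltcR. Qed.

Lemma rnorm0 : rnorm (0 : V) = 0.
Proof. by rewrite /rnorm normr0. Qed.

Lemma rnorm0_eq0 x : rnorm x = 0 -> x = 0.
Proof. by move=> x0; apply/normr0_eq0; rewrite rnormE x0. Qed.

Lemma rnormD x y : rnorm (x + y) <= rnorm x + rnorm y.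
Proof. by rewrite rnorm_le rmorphD/= -!rnormE ler_normD. Qed.

Lemma rnormN x : rnorm (- x) = rnorm x.
Proof. by rewrite /rnorm normrN. Qed.

Lemma rnormB x y : rnorm (x - y) = rnorm (y - x).
Proof. by rewrite -rnormN opprB. Qed.

Lemma rnormZ (a : R[i]) x : rnorm (a *: x) = complex.Re `|a| * rnorm x.
Proof.
have : (rnorm (a *: x))%:C = (complex.Re `|a| * rnorm x)%:C.
  by rewrite rmorphM/= RRe_real ?normr_real// -!rnormE normrZ.
exact: complexI.
Qed.

Lemma rnormZr (a : R) x : 0 <= a -> rnorm (a%:C *: x) = a * rnorm x.
Proof. by move=> a0; rewrite rnormZ ger0_norm// lecR. Qed.

Lemma rnorm_cvgP (T : Type) (F : set_system T) (FF : Filter F) (f : T -> V) x :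
  f @ F --> x <-> forall e : R, 0 < e -> \forall t \near F, rnorm (x - f t) < e.
Proof.
split=> [/cvgrPdist_lt fx e e0|fx].
  have e0' : 0 < e%:C by rewrite ltcR.
  by apply: filterS (fx _ e0') => t; rewrite rnorm_lt.
apply/cvgrPdist_lt => e; case: e => a b; rewrite ltcE/= => /andP[/eqP-> a0].
by apply: filterS (fx _ a0) => t; rewrite rnorm_lt.
Qed.

Lemma rnorm_ballE x (e : R) y : ball x e%:C y = (rnorm (x - y) < e) :> Prop.
Proof. by rewrite -ball_normE /ball_/= rnorm_lt. Qed.

Lemma rnorm_cauchyP (F : set_system V) (FF : ProperFilter F) :
  cauchy F <-> forall e : R, 0 < e -> exists x, F [set y | rnorm (x - y) < e].
Proof.
rewrite cauchyP; split=> [cF e e0|cF].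
  have e0' : 0 < e%:C by rewrite ltcR.
  have [x xF] := cF _ e0'; exists x; apply: filterS xF => y.
  by rewrite rnorm_ballE.
move=> [a b]; rewrite ltcE/= => /andP[/eqP-> a0].
have [x xF] := cF _ a0; exists x; apply: filterS xF => y.
by move=> /= xy; rewrite -/(a%:C) rnorm_ballE.
Qed.

End RealNorm.

Definition totally_bounded_set (R : realType) (V : normedModType R[i])
    (A : set V) := forall e : R, 0 < e ->
  exists s : seq V, forall a, A a -> exists2 v, v \in s & rnorm (v - a) < e.

Lemma ultra_seq (T : choiceType) (I : eqType) (G : set_system T)
    (UG : UltraFilter G) (s : seq I) (P : I -> set T) :
  G [set x | exists2 i, i \in s & P i x] -> exists2 i, i \in s & G (P i).
Proof.
elim: s => [|i s IH] Gs.
  have [x [? //]] := filter_ex Gs.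
have [Gi|Gi] := in_ultra_setVsetC (P i) UG.
  by exists i => //; rewrite mem_head.
have [|j js Gj] := IH.
  apply: filterS (filterI Gs Gi) => x [[j]]; rewrite inE => /orP[/eqP->//|js Pj _].
  by exists j.
by exists j => //; rewrite inE js orbT.
Qed.

Lemma precompact_totally_bounded (R : realType) (V : completeNormedModType R[i])
    (A : set V) : precompact A <-> totally_bounded_set A.
Proof.
split=> [|tA].
  rewrite precompactE => /[dup] cA; rewrite compact_cover => /= cov e e0.
  have e0' : 0 < e%:C by rewrite ltcR.
  have [||D _ AD] := cov V [set: V] (fun v : V => (ball v e%:C)°).
  - by move=> v _; exact: open_interior.
  - move=> v _; exists v => //; exact: (nbhsx_ballx v _ e0').
  exists (enum_fset D) => a /subset_closure/AD[v /= vD] /interior_subset.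
  by rewrite rnorm_ballE; exists v.
rewrite precompactE compact_ultra => G UG GA.
have GP := @ultra_proper _ _ UG.
have : cauchy G.
  apply/rnorm_cauchyP => e e0.
  have e20 : 0 < e / 2 by lra.
  have [s sA] := tA _ e20.
  have [|v vs Gv] := @ultra_seq _ _ G UG s (fun v => [set y | rnorm (v - y) < e]).
    apply: filterS GA => x /= clx.
    have e0' : 0 < (e / 2)%:C by rewrite ltcR.
    have [a [Aa]] := clx _ (nbhsx_ballx x _ e0').
    rewrite rnorm_ballE => xa; have [v vs va] := sA _ Aa; exists v => //=.
    rewrite -(subrK a v) -addrA (le_lt_trans (rnormD _ _))//.
    by rewrite [e]splitr ltrD// rnormB.
  by exists v.
move=> /cauchy_cvg Gc; exists (lim G); split => //.
by apply: (@closed_cvg _ _ G _ id (closure A) (@closed_closure V A)); rewrite ?fmapE//.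
Qed.

(* Complex Hilbert spaces. The inner product [ip] is linear in its first argument
   and conjugate-linear in the second. *)
HB.mixin Record CompleteNormedModule_isHilbert (R : realType) H
    of CompleteNormedModule R[i] H := {
  ip : {dot H for (@Num.conj R[i])};
  ip_norm : forall x : H, ip x x = `|x| ^+ 2 }.

#[short(type="hilbertType")]
HB.structure Definition Hilbert (R : realType) :=
  {H of CompleteNormedModule_isHilbert R H & CompleteNormedModule R[i] H}.

Section HilbertTheory.
Variables (R : realType) (H : hilbertType R).
Implicit Types (x y z : H) (a : R[i]).

Lemma ipDl x y z : ip (x + y) z = ip x z + ip y z.
Proof. exact: (linearDl (ip : {dot H for (@Num.conj R[i])})). Qed.
Lemma ipZl a x y : ip (a *: x) y = a * ip x y.
Proof. exact: (linearZl_LR (ip : {dot H for (@Num.conj R[i])})). Qed.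
Lemma ipC x y : ip x y = (ip y x)^*.
Proof.
by have := hermC (ip : {dot H for (@Num.conj R[i])}) x y; rewrite expr0 mul1r.
Qed.
Lemma ipDr x y z : ip z (x + y) = ip z x + ip z y.
Proof. by rewrite ipC ipDl rmorphD/= -!ipC. Qed.
Lemma ipZr a x y : ip y (a *: x) = a^* * ip y x.
Proof. by rewrite ipC ipZl rmorphM/= -!ipC. Qed.
Lemma ip0l x : ip 0 x = 0.
Proof. by rewrite -(scale0r x) ipZl mul0r. Qed.
Lemma ip0r x : ip x 0 = 0.
Proof. by rewrite ipC ip0l rmorph0. Qed.
Lemma ipNl x y : ip (- x) y = - ip x y.
Proof. by rewrite -scaleN1r ipZl mulN1r. Qed.
Lemma ipNr x y : ip x (- y) = - ip x y.
Proof. by rewrite ipC ipNl rmorphN/= -ipC. Qed.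
Lemma ipBl x y z : ip (x - y) z = ip x z - ip y z.
Proof. by rewrite ipDl ipNl. Qed.
Lemma ipBr x y z : ip z (x - y) = ip z x - ip z y.
Proof. by rewrite ipDr ipNr. Qed.
Lemma ip_suml (I : Type) (r : seq I) (P : pred I) (F : I -> H) y :
  ip (\sum_(i <- r | P i) F i) y = \sum_(i <- r | P i) ip (F i) y.
Proof.
elim/big_rec2: _ => [|i a b _ <-]; first by rewrite ip0l.
by rewrite ipDl.
Qed.

Definition reip x y : R := complex.Re (ip x y).

Lemma reipDl x y z : reip (x + y) z = reip x z + reip y z.
Proof. by rewrite /reip ipDl raddfD. Qed.
Lemma reipC x y : reip x y = reip y x.
Proof. by rewrite /reip ipC; case: (ip y x). Qed.
Lemma reipDr x y z : reip z (x + y) = reip z x + reip z y.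
Proof. by rewrite !(reipC z) reipDl. Qed.
Lemma reipNl x y : reip (- x) y = - reip x y.
Proof. by rewrite /reip ipNl raddfN. Qed.
Lemma reipNr x y : reip x (- y) = - reip x y.
Proof. by rewrite !(reipC x) reipNl. Qed.
Lemma reipZl (t : R) x y : reip (t%:C *: x) y = t * reip x y.
Proof. by rewrite /reip ipZl; case: (ip x y) => a b /=; rewrite mul0r subr0. Qed.
Lemma reipZr (t : R) x y : reip x (t%:C *: y) = t * reip x y.
Proof. by rewrite !(reipC x) reipZl. Qed.
Lemma reip0r x : reip x 0 = 0.
Proof. by rewrite /reip ip0r. Qed.
Lemma reip_norm x : reip x x = rnorm x ^+ 2.
Proof. by rewrite /reip ip_norm rnormE -rmorphXn. Qed.
Lemma reip_suml (I : Type) (r : seq I) (P : pred I) (F : I -> H) y :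
  reip (\sum_(i <- r | P i) F i) y = \sum_(i <- r | P i) reip (F i) y.
Proof. by rewrite /reip ip_suml raddf_sum. Qed.

Lemma rnorm_sqD x y :
  rnorm (x + y) ^+ 2 = rnorm x ^+ 2 + 2 * reip x y + rnorm y ^+ 2.
Proof.
by rewrite -!reip_norm reipDl !reipDr (reipC y x); ring.
Qed.

Lemma reip_le x y : reip x y <= rnorm x * rnorm y.
Proof.
have x0 := rnorm_ge0 x; have y0 := rnorm_ge0 y.
have [/eqP xy0|xy0] := eqVneq (rnorm x * rnorm y) 0.
  rewrite (eqP xy0); move: xy0; rewrite mulf_eq0 => /orP[] /eqP/rnorm0_eq0 ->.
    by rewrite reipC reip0r.
  by rewrite reip0r.
have xy1 : 0 < rnorm x * rnorm y by rewrite lt_neqAle eq_sym xy0 mulr_ge0.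
have := sqr_ge0 (rnorm ((rnorm y)%:C *: x - (rnorm x)%:C *: y)).
rewrite rnorm_sqD reipNr reipZl reipZr rnormN !rnormZr// => h.
rewrite -(ler_pM2l xy1); nra.
Qed.

Lemma ip_inj y z : (forall x, ip x y = ip x z) -> y = z.
Proof.
move=> yz; apply/eqP; rewrite -subr_eq0; apply/eqP/rnorm0_eq0.
apply/eqP; rewrite -sqrf_eq0 -reip_norm /reip ipBr yz subrr.
by [].
Qed.

Lemma ip_of_reip (phi : H -> R[i]) z :
  (forall a x, phi (a *: x) = a * phi x) ->
  (forall x, complex.Re (phi x) = reip x z) -> forall x, phi x = ip x z.
Proof.
move=> phiZ phiz x; have := phiz x; have := phiz ('i *: x).
rewrite /reip ipZl phiZ !(mulrC 'i) !ReiNIm => /oppr_inj.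
by case: (phi x) => a b; case: (ip x z) => a' b' /= -> ->.
Qed.

Lemma riesz_re (psi : H -> R) (M : R) : 0 <= M ->
  (forall x y, psi (x + y) = psi x + psi y) ->
  (forall t x, psi (t%:C *: x) = t * psi x) ->
  (forall x, psi x <= M * rnorm x) ->
  exists z, forall x, psi x = reip x z.
Proof.
move=> M0 psiD psiZ psiM.
pose J x := rnorm x ^+ 2 - 2 * psi x.
have Jlb : lbound (range J) (- M ^+ 2).
  move=> _ [x _ <-]; rewrite /J.
  have := psiM x; have := sqr_ge0 (rnorm x - M); rewrite sqrrB; nra.
have Jinf : has_inf (range J) by split; [exists (J 0), 0 | exists (- M ^+ 2)].
pose d := inf (range J).
have dJ x : d <= J x by apply: ge_inf; [exact: Jinf.2|exists x].
pose G : set_system H := filter_from [set e : R | 0 < e] (fun e => [set x | J x < d + e]).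
have GP : ProperFilter G.
  apply: filter_from_proper; last first.
    move=> e e0; have [_ [x _ <-] xe] := inf_adherent e0 Jinf.
    by exists x.
  apply: filter_from_filter; first by exists 1 => /=.
  move=> e f /= e0 f0; exists (Num.min e f); first by rewrite /= lt_min e0.
  move=> x /=; case: (leP e f) => ef h; split => //=.
    by rewrite (lt_le_trans h)// lerD2l.
  by rewrite (lt_le_trans h)// lerD2l ltW.
have psiN x : psi (- x) = - psi x.
  by rewrite -scaleN1r -[-1]/(- (1%:C)) -rmorphN psiZ mulN1r.
have par x y e : J x < d + e -> J y < d + e -> rnorm (x - y) ^+ 2 <= 4 * e.
  move=> xe ye; have := dJ ((2^-1)%:C *: (x + y)).
  rewrite /J psiZ psiD rnormZr ?invr_ge0// exprMn rnorm_sqD.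
  move: xe ye; rewrite /J rnorm_sqD reipNr rnormN.
  set a := rnorm x ^+ 2; set b := rnorm y ^+ 2; set c := reip x y.
  lra.
have : cauchy G.
  apply/rnorm_cauchyP => e e0; have e1 : 0 < e ^+ 2 / 8 by rewrite divr_gt0 ?exprn_gt0.
  have [_ [x _ <-] xe] := inf_adherent e1 Jinf.
  exists x, (e ^+ 2 / 8) => // y ye /=.
  have := par _ _ _ xe ye; have := rnorm_ge0 (x - y) => n0 n1.
  rewrite -(@ltr_pXn2r _ 2)// ?nnegrE// ?(ltW e0)//.
  apply: le_lt_trans n1 _; have := exprn_gt0 2 e0; lra.
move=> /cauchy_cvg Gc; pose z := lim G.
have /(@rnorm_cvgP _ _ _ G _ id) Gz : id @ G --> z by [].
have Jz : J z <= d.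
  apply/ler_addgt0Pr => e e0.
  pose C := 2 * (rnorm z + 1 + M) + 1.
  have z0 := rnorm_ge0 z.
  have C0 : 0 < C by rewrite /C; lra.
  pose del := Num.min 1 (e / 2 / C).
  have del0 : 0 < del by rewrite lt_min ltr01 !divr_gt0.
  have e20 : 0 < e / 2 by lra.
  have GJ : G [set x | J x < d + e / 2] by exists (e / 2).
  have [x [/= xJ xz]] := filter_ex (filterI GJ (Gz _ del0)).
  have del1 : del <= 1 by rewrite ge_min lexx.
  have delC : del * C <= e / 2 by rewrite -ler_pdivlMr// ge_min lexx orbT.
  have zx : rnorm (- (z - x) + z) <= del + rnorm z.
    by apply: (le_trans (rnormD _ _)); rewrite rnormN lerD2r ltW.
  rewrite opprB subrK in zx.
  have Jzx : J z = J x + rnorm (z - x) ^+ 2 + 2 * reip x (z - x) + 2 * psi (- (z - x)).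
    rewrite psiN psiD psiN /J; have := rnorm_sqD x (z - x); rewrite addrC subrK => ->.
    lra.
  rewrite Jzx.
  have := reip_le x (z - x); have := psiM (- (z - x)); rewrite rnormN.
  have := rnorm_ge0 (z - x); have := rnorm_ge0 x.
  move: xz zx delC xJ; rewrite /C.
  move: (rnorm (z - x)) (rnorm x) (reip _ _) (psi _) (J x) (rnorm z) z0 => w u r p j zz z0.
  move=> wd ud dC jd u0 w0 pw rw.
  have : u * w <= (del + zz) * del by apply: ler_pM => //; exact: ltW.
  have : M * w <= M * del by apply: ler_wpM2l => //; exact: ltW.
  have : w ^+ 2 <= del * 1.
    by rewrite expr2; apply: ler_pM => //; [exact: ltW|apply: ltW; lra].
  nra.
exists z => h; apply/eqP; rewrite -subr_eq0.
set a := psi h - reip h z; pose q := rnorm h ^+ 2.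
have q0 : 0 <= q by exact: sqr_ge0.
have := le_trans Jz (dJ (z + (a / (q + 1))%:C *: h)).
rewrite /J rnorm_sqD psiD psiZ reipZr (reipC z h).
have -> : rnorm ((a / (q + 1))%:C *: h) ^+ 2 = (a / (q + 1)) ^+ 2 * q.
  by rewrite -reip_norm reipZl reipZr reip_norm /q; ring.
set s := (q + 1)^-1.
have s1 : s * (q + 1) = 1 by rewrite mulVf//; lra.
have s0 : 0 < s by rewrite invr_gt0; lra.
have -> : reip h z = psi h - a by rewrite /a; ring.
move=> hh.
have : 0 <= a ^+ 2 * s * (s * q - 2) by nra.
have sq : s * q - 2 < 0 by nra.
rewrite -mulrA => h2.
have : a ^+ 2 <= 0.
  have h3 : s * (s * q - 2) < 0 by nra.
  rewrite leNgt; apply/negP => a0; nra.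
by rewrite le_eqVlt ltNge sqr_ge0 orbF sqrf_eq0.
Qed.

End HilbertTheory.

(* B(H), with composition as product and the operator norm. *)
Record bounded_op (R : realType) (H : hilbertType R) := BoundedOp {
  bop_fun :> H -> H;
  bop_linear : linear bop_fun;
  bop_bounded : exists M : R, forall x, rnorm (bop_fun x) <= M * rnorm x }.

Section BoundedOpLmodule.
Variables (R : realType) (H : hilbertType R).
Local Notation BH := (bounded_op H).

HB.instance Definition _ := gen_eqMixin BH.
HB.instance Definition _ := gen_choiceMixin BH.

HB.instance Definition _ (f : BH) :=
  GRing.isLinear.Build R[i] H H _ (bop_fun f) (bop_linear f).

Lemma bopP (f g : BH) : (forall x, f x = g x) <-> f = g.
Proof.
split=> [|->//]; case: f g => [f lf bf] [g lg bg] /= /funext fg.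
by case: _ / fg in lg bg *; congr BoundedOp; exact: Prop_irrelevance.
Qed.

Lemma bop_boundedP (f : BH) :
  exists2 M : R, 0 <= M & forall x, rnorm (f x) <= M * rnorm x.
Proof.
have [M fM] := bop_bounded f; exists (Num.max 0 M); first by rewrite le_max lexx.
move=> x; apply: le_trans (fM x) _.
by apply: ler_wpM2r; rewrite ?rnorm_ge0// le_max lexx orbT.
Qed.

Fact bop0_linear : linear (fun _ : H => 0 : H).
Proof. by move=> a x y; rewrite scaler0 addr0. Qed.
Fact bop0_bounded : exists M : R, forall x : H, rnorm (0 : H) <= M * rnorm x.
Proof. by exists 0 => x; rewrite rnorm0 mul0r. Qed.
Definition bop0 : BH := BoundedOp bop0_linear bop0_bounded.

Fact bopD_linear (f g : BH) : linear (fun x => f x + g x).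
Proof. by move=> a x y; rewrite !linearP scalerDr addrACA. Qed.
Fact bopD_bounded (f g : BH) :
  exists M : R, forall x, rnorm (f x + g x) <= M * rnorm x.
Proof.
have [M _ fM] := bop_boundedP f; have [N _ gN] := bop_boundedP g.
by exists (M + N) => x; rewrite (le_trans (rnormD _ _))// mulrDl lerD.
Qed.
Definition bopD (f g : BH) : BH := BoundedOp (bopD_linear f g) (bopD_bounded f g).

Fact bopZ_linear (a : R[i]) (f : BH) : linear (fun x => a *: f x).
Proof. by move=> b x y; rewrite linearP scalerDr !scalerA mulrC. Qed.
Fact bopZ_bounded (a : R[i]) (f : BH) :
  exists M : R, forall x, rnorm (a *: f x) <= M * rnorm x.
Proof.
have [M _ fM] := bop_boundedP f; exists (complex.Re `|a| * M) => x.
rewrite rnormZ -mulrA ler_wpM2l//; exact: (rnorm_ge0 (a : R[i]^o)).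
Qed.
Definition bopZ (a : R[i]) (f : BH) : BH :=
  BoundedOp (bopZ_linear a f) (bopZ_bounded a f).

Fact bopN_linear (f : BH) : linear (fun x => - f x).
Proof. by move=> b x y; rewrite linearP opprD scalerN. Qed.
Fact bopN_bounded (f : BH) : exists M : R, forall x, rnorm (- f x) <= M * rnorm x.
Proof.
by have [M _ fM] := bop_boundedP f; exists M => x; rewrite rnormN.
Qed.
Definition bopN (f : BH) : BH := BoundedOp (bopN_linear f) (bopN_bounded f).

Fact bop1_linear : linear (@id H). Proof. by []. Qed.
Fact bop1_bounded : exists M : R, forall x : H, rnorm x <= M * rnorm x.
Proof. by exists 1 => x; rewrite mul1r. Qed.
Definition bop1 : BH := BoundedOp bop1_linear bop1_bounded.

Fact bopM_linear (f g : BH) : linear (f \o g).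
Proof. by move=> a x y /=; rewrite !linearP. Qed.
Fact bopM_bounded (f g : BH) :
  exists M : R, forall x, rnorm ((f \o g) x) <= M * rnorm x.
Proof.
have [M M0 fM] := bop_boundedP f; have [N _ gN] := bop_boundedP g.
by exists (M * N) => x /=; rewrite (le_trans (fM _))// -mulrA ler_wpM2l.
Qed.
Definition bopM (f g : BH) : BH := BoundedOp (bopM_linear f g) (bopM_bounded f g).

Fact bopDA : associative bopD.
Proof. by move=> f g h; apply/bopP => x /=; rewrite addrA. Qed.
Fact bopDC : commutative bopD.
Proof. by move=> f g; apply/bopP => x /=; rewrite addrC. Qed.
Fact bop0D : left_id bop0 bopD.
Proof. by move=> f; apply/bopP => x /=; rewrite add0r. Qed.
Fact bopND : left_inverse bop0 bopN bopD.
Proof. by move=> f; apply/bopP => x /=; rewrite addNr. Qed.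
HB.instance Definition _ := GRing.isZmodule.Build BH bopDA bopDC bop0D bopND.

Fact bopMA : associative bopM. Proof. by move=> f g h; apply/bopP. Qed.
Fact bop1M : left_id bop1 bopM. Proof. by move=> f; apply/bopP. Qed.
Fact bopM1 : right_id bop1 bopM. Proof. by move=> f; apply/bopP. Qed.
Fact bopMDl : left_distributive bopM +%R.
Proof. by move=> f g h; apply/bopP. Qed.
Fact bopMDr : right_distributive bopM +%R.
Proof. by move=> f g h; apply/bopP => x /=; rewrite linearD. Qed.
HB.instance Definition _ :=
  GRing.Zmodule_isPzRing.Build BH bopMA bop1M bopM1 bopMDl bopMDr.

Fact bopZA a b (f : BH) : bopZ a (bopZ b f) = bopZ (a * b) f.
Proof. by apply/bopP => x /=; rewrite scalerA. Qed.
Fact bop1Z : left_id 1 bopZ.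
Proof. by move=> f; apply/bopP => x /=; rewrite scale1r. Qed.
Fact bopZDr : right_distributive bopZ +%R.
Proof. by move=> a f g; apply/bopP => x /=; rewrite scalerDr. Qed.
Fact bopZDl (f : BH) : {morph bopZ^~ f : a b / a + b}.
Proof. by move=> a b; apply/bopP => x /=; rewrite scalerDl. Qed.
HB.instance Definition _ :=
  GRing.Zmodule_isLmodule.Build R[i] BH bopZA bop1Z bopZDr bopZDl.

Lemma bopDE (f g : BH) x : (f + g) x = f x + g x. Proof. by []. Qed.
Lemma bopNE (f : BH) x : (- f) x = - f x. Proof. by []. Qed.
Lemma bopBE (f g : BH) x : (f - g) x = f x - g x. Proof. by []. Qed.
Lemma bopME (f g : BH) x : (f * g) x = f (g x). Proof. by []. Qed.
Lemma bopZE a (f : BH) x : (a *: f) x = a *: f x. Proof. by []. Qed.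
Lemma bop_sumE (I : Type) (r : seq I) (P : pred I) (F : I -> BH) x :
  (\sum_(i <- r | P i) F i) x = \sum_(i <- r | P i) F i x.
Proof. by elim/big_rec2: _ => //= i a b _ <-. Qed.

Definition opnorm (f : BH) : R :=
  sup [set rnorm (f x) | x in [set x | rnorm x <= 1]].

Lemma opnorm_has_sup (f : BH) :
  has_sup [set rnorm (f x) | x in [set x | rnorm x <= 1]].
Proof.
split; first by exists (rnorm (f 0)), 0; rewrite //= rnorm0.
have [M M0 fM] := bop_boundedP f; exists M => _ [x /= x1 <-].
by rewrite (le_trans (fM x))// -[leRHS]mulr1 ler_wpM2l.
Qed.

Lemma opnorm_ge0 (f : BH) : 0 <= opnorm f.
Proof.
apply: (@le_trans _ _ (rnorm (f 0))); first exact: rnorm_ge0.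
by apply: ub_le_sup (opnorm_has_sup f).2 _ _; exists 0; rewrite //= rnorm0.
Qed.

Lemma opnormP (f : BH) x : rnorm (f x) <= opnorm f * rnorm x.
Proof.
have [/rnorm0_eq0 ->|x0] := eqVneq (rnorm x) 0.
  by rewrite linear0 !rnorm0 mulr0.
have x1 : 0 < rnorm x by rewrite lt_neqAle eq_sym x0 rnorm_ge0.
rewrite -ler_pdivrMr// mulrC -rnormZr ?invr_ge0 ?rnorm_ge0// -linearZ.
apply: ub_le_sup (opnorm_has_sup f).2 _ _; eexists; last reflexivity.
by rewrite /= rnormZr ?invr_ge0 ?rnorm_ge0// mulVf.
Qed.

Lemma opnorm_le (f : BH) (c : R) : 0 <= c ->
  (forall x, rnorm (f x) <= c * rnorm x) -> opnorm f <= c.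
Proof.
move=> c0 fc; apply: ge_sup; first exact: (opnorm_has_sup f).1.
by move=> _ [x /= x1 <-]; rewrite (le_trans (fc x))// -[leRHS]mulr1 ler_wpM2l.
Qed.

Fact opnormD (f g : BH) : (opnorm (f + g))%:C <= (opnorm f)%:C + (opnorm g)%:C.
Proof.
rewrite -rmorphD lecR; apply: opnorm_le; first by rewrite addr_ge0 ?opnorm_ge0.
by move=> x; rewrite (le_trans (rnormD _ _))// mulrDl lerD// opnormP.
Qed.

Fact opnormZ (a : R[i]) (f : BH) : (opnorm (a *: f))%:C = `|a| * (opnorm f)%:C.
Proof.
have nZ b (g : BH) : opnorm (b *: g) <= complex.Re `|b| * opnorm g.
  apply: opnorm_le => [|x].
    by rewrite mulr_ge0 ?opnorm_ge0//; exact: (rnorm_ge0 (b : R[i]^o)).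
  rewrite rnormZ -mulrA ler_wpM2l ?opnormP//; exact: (rnorm_ge0 (b : R[i]^o)).
have -> : `|a| = (complex.Re `|a|)%:C by rewrite RRe_real ?normr_real.
rewrite -rmorphM; congr (_%:C); apply/eqP; rewrite eq_le nZ andTb.
have [->|a0] := eqVneq a 0; first by rewrite normr0 mul0r opnorm_ge0.
have a1 : 0 < complex.Re `|a|.
  by rewrite -ltcR RRe_real ?normr_real// normr_gt0.
rewrite mulrC -ler_pdivlMr// mulrC.
have := nZ a^-1 (a *: f); rewrite scalerA mulVf// scale1r => /le_trans; apply.
rewrite normfV ler_wpM2r ?opnorm_ge0//.
suff -> : complex.Re `|a|^-1 = (complex.Re `|a|)^-1 by [].
by apply: complexI; rewrite fmorphV !RRe_real ?normr_real//.
Qed.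

Fact opnorm0_eq0 (f : BH) : (opnorm f)%:C = 0 -> f = 0.
Proof.
move=> /complexI f0; apply/bopP => x; apply: rnorm0_eq0; apply/eqP.
by rewrite eq_le rnorm_ge0 andbT (le_trans (opnormP f x))// f0 mul0r.
Qed.

HB.instance Definition _ :=
  Lmodule_isNormed.Build R[i] BH opnormD opnormZ opnorm0_eq0.

Lemma rnorm_bop (f : BH) : rnorm f = opnorm f. Proof. by []. Qed.

Lemma rnorm_bopP (f : BH) x : rnorm (f x) <= rnorm f * rnorm x.
Proof. exact: opnormP. Qed.

Lemma rnorm_bop_le (f : BH) (c : R) : 0 <= c ->
  (forall x, rnorm (f x) <= c * rnorm x) -> rnorm f <= c.
Proof. exact: opnorm_le. Qed.

Lemma rnorm_bopM (f g : BH) : rnorm (f * g) <= rnorm f * rnorm g.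
Proof.
apply: rnorm_bop_le => [|x]; first by rewrite mulr_ge0 ?rnorm_ge0.
rewrite bopME (le_trans (rnorm_bopP _ _))// -mulrA ler_wpM2l ?rnorm_ge0//.
exact: rnorm_bopP.
Qed.

Fact bop_complete (F : set_system BH) : ProperFilter F -> cauchy F -> cvg F.
Proof.
move=> FF cF; have /rnorm_cauchyP cF' := cF.
have cv x : cvg ((fun f : BH => f x) @ F).
  apply: cauchy_cvg; apply/rnorm_cauchyP => e e0.
  have e1 : 0 < e / (rnorm x + 1) by rewrite divr_gt0// ltr_wpDl ?rnorm_ge0.
  have [f Ff] := cF' _ e1; exists (f x).
  suff : F [set g : BH | rnorm (f x - g x) < e] by [].
  apply: filterS Ff => g /= fg.
  rewrite -bopBE (le_lt_trans (rnorm_bopP _ _))//.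
  rewrite (@le_lt_trans _ _ (rnorm (f - g) * (rnorm x + 1)))//.
    by rewrite ler_wpM2l ?rnorm_ge0// lerDl.
  by rewrite -ltr_pdivlMr// ltr_wpDl ?rnorm_ge0.
pose l x := lim ((fun f : BH => f x) @ F).
have llin : linear l.
  move=> a x y; apply: cvg_lim => //.
  have -> : (fun f : BH => f (a *: x + y)) = (fun f : BH => a *: f x + f y).
    by apply/funext => f; rewrite linearP.
  by apply: cvgD; [apply: cvgZr; exact: cv|exact: cv].
have lP x (f : BH) (e : R) : F [set g | rnorm (f - g) < e] ->
    rnorm (f x - l x) <= e * rnorm x.
  move=> Ff; apply/ler_addgt0Pr => d d0.
  have /rnorm_cvgP/(_ _ d0) Fd := cv x.
  have [g /= [fg gd]] := filter_ex (filterI Ff Fd).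
  rewrite -(subrK (g x) (f x)) -addrA (le_trans (rnormD _ _))// lerD//.
    rewrite -bopBE (le_trans (rnorm_bopP _ _))// ler_wpM2r ?rnorm_ge0//.
    exact: ltW.
  by rewrite rnormB ltW.
have lbd : exists M : R, forall x, rnorm (l x) <= M * rnorm x.
  have [f Ff] := cF' _ ltr01; exists (1 + rnorm f) => x.
  rewrite -(subrK (f x) (l x)) (le_trans (rnormD _ _))// mulrDl lerD//.
    by rewrite rnormB lP.
  exact: rnorm_bopP.
apply/cvg_ex; exists (BoundedOp llin lbd).
apply/(@rnorm_cvgP _ _ _ F _ id) => e e0.
have e20 : 0 < e / 3 by lra.
have [f Ff] := cF' _ e20; apply: filterS (Ff) => g /= fg.
rewrite -(subrK f (BoundedOp _ _)) -addrA (le_lt_trans (rnormD _ _))//.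
suff : rnorm (BoundedOp llin lbd - f) <= e / 3 by move: fg; lra.
apply: rnorm_bop_le => [|x]; first exact: ltW.
by rewrite bopBE rnormB; exact: lP.
Qed.

HB.instance Definition _ := Uniform_isComplete.Build BH bop_complete.

End BoundedOpLmodule.

Section Adjoint.
Variables (R : realType) (H : hilbertType R).
Local Notation BH := (bounded_op H).

(* The set below is a singleton, by Riesz representation ([adjP], [adj_uniq]). *)
Definition adj (f : BH) : BH :=
  xget 0 [set g : BH | forall x y, ip (f x) y = ip x (g y)].

Lemma adjP (f : BH) x y : ip (f x) y = ip x (adj f y).
Proof.
rewrite /adj; case: xgetP => [g _ ->//|/(_ _) fN].
have fz w : exists z, forall x, ip (f x) w = ip x z.
  have [z zP] : exists z, forall x, reip (f x) w = reip x z.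
    apply: (@riesz_re _ _ _ (rnorm f * rnorm w)) => [|u v|t u|u].
    - by rewrite mulr_ge0 ?rnorm_ge0.
    - by rewrite linearD reipDl.
    - by rewrite linearZ reipZl.
    - rewrite (le_trans (reip_le _ _))// mulrAC ler_wpM2r ?rnorm_ge0//.
      exact: rnorm_bopP.
  exists z; apply: ip_of_reip => [a u|u]; first by rewrite linearZ ipZl.
  exact: zP.
have [g gP] := choice fz.
have glin : linear g.
  move=> a u v; apply: ip_inj => w.
  by rewrite -gP !ipDr !ipZr !gP.
have gbd : exists M : R, forall u, rnorm (g u) <= M * rnorm u.
  exists (rnorm f) => u.
  have [->|g0] := eqVneq (rnorm (g u)) 0; first by rewrite mulr_ge0 ?rnorm_ge0.
  have g1 : 0 < rnorm (g u) by rewrite lt_neqAle eq_sym g0 rnorm_ge0.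
  rewrite -(ler_pM2l g1) -expr2 -reip_norm /reip -gP -/(reip _ _).
  rewrite (le_trans (reip_le _ _))// mulrA ler_wpM2r ?rnorm_ge0// mulrC.
  exact: rnorm_bopP.
by have /= := fN (BoundedOp glin gbd) (fun u v => gP v u).
Qed.

Lemma adj_uniq (f g : BH) : (forall x y, ip (f x) y = ip x (g y)) -> adj f = g.
Proof.
by move=> fg; apply/bopP => y; apply: ip_inj => x; rewrite -fg adjP.
Qed.

Lemma adjM (f g : BH) : adj (f * g) = adj g * adj f.
Proof. by apply: adj_uniq => x y; rewrite !bopME -!adjP. Qed.

Lemma rnorm_adj_le (f : BH) : rnorm (adj f) <= rnorm f.
Proof.
apply: rnorm_bop_le => [|y]; first exact: rnorm_ge0.
set z := adj f y.
have [->|z0] := eqVneq (rnorm z) 0; first by rewrite mulr_ge0 ?rnorm_ge0.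
have z1 : 0 < rnorm z by rewrite lt_neqAle eq_sym z0 rnorm_ge0.
rewrite -(ler_pM2l z1) -expr2 -reip_norm /reip {2}/z -adjP -/(reip _ _).
rewrite (le_trans (reip_le _ _))// mulrA ler_wpM2r ?rnorm_ge0// mulrC.
exact: rnorm_bopP.
Qed.

End Adjoint.

Section CompactOp.
Variables (R : realType) (H : hilbertType R).
Local Notation BH := (bounded_op H).

(* B_0(H), as a subset of B(H). *)
Definition compact_op : set BH :=
  [set f | precompact (f @` [set x | rnorm x <= 1])].

Lemma compact_opP (f : BH) : compact_op f <->
  totally_bounded_set (f @` [set x | rnorm x <= 1]).
Proof. exact: precompact_totally_bounded. Qed.

Lemma compact_op0 : compact_op 0.
Proof.
apply/compact_opP => e e0; exists [:: 0] => _ [x _ <-].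
by exists 0; rewrite ?mem_head// subr0 rnorm0.
Qed.

Lemma compact_opD (f g : BH) : compact_op f -> compact_op g -> compact_op (f + g).
Proof.
move=> /compact_opP fc /compact_opP gc; apply/compact_opP => e e0.
have e20 : 0 < e / 2 by lra.
have [s sP] := fc _ e20; have [t tP] := gc _ e20.
exists [seq a + b | a <- s, b <- t] => _ [x x1 <-].
have [a sa ax] := sP _ (imageP _ x1); have [b tb bx] := tP _ (imageP _ x1).
exists (a + b); first by apply/allpairsP; exists (a, b).
by rewrite bopDE opprD addrACA (le_lt_trans (rnormD _ _))// [e]splitr ltrD.
Qed.

Lemma compact_op_mull (g f : BH) : compact_op f -> compact_op (g * f).
Proof.
move=> /compact_opP fc; apply/compact_opP => e e0.
have g1 : 0 < rnorm g + 1 by rewrite ltr_wpDl ?rnorm_ge0.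
have e1 : 0 < e / (rnorm g + 1) by rewrite divr_gt0.
have [s sP] := fc _ e1; exists (map g s) => _ [x x1 <-].
have [v sv vx] := sP _ (imageP _ x1); exists (g v); first by rewrite map_f.
rewrite bopME -linearB (le_lt_trans (rnorm_bopP _ _))//.
rewrite (@le_lt_trans _ _ ((rnorm g + 1) * rnorm (v - f x)))//.
  by rewrite ler_wpM2r ?rnorm_ge0// lerDl.
by rewrite mulrC -ltr_pdivlMr.
Qed.

Lemma compact_opZ a (f : BH) : compact_op f -> compact_op (a *: f).
Proof.
by move=> /(compact_op_mull (bopZ a 1)).
Qed.

Lemma compact_opN (f : BH) : compact_op f -> compact_op (- f).
Proof. by move=> /(compact_opZ (-1)); rewrite scaleN1r. Qed.

Lemma compact_op_sum (I : Type) (r : seq I) (P : pred I) (F : I -> BH) :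
  (forall i, P i -> compact_op (F i)) -> compact_op (\sum_(i <- r | P i) F i).
Proof.
by move=> cF; elim/big_ind: _ => //; [exact: compact_op0|exact: compact_opD].
Qed.

Lemma compact_op_lim (T : Type) (F : set_system T) (FF : ProperFilter F)
    (u : T -> BH) (f : BH) :
  (forall t, compact_op (u t)) -> u @ F --> f -> compact_op f.
Proof.
move=> uc /rnorm_cvgP uf; apply/compact_opP => e e0.
have e20 : 0 < e / 2 by lra.
have [t ft] := filter_ex (uf _ e20).
have /compact_opP /(_ _ e20)[s sP] := uc t; exists s => _ [x x1 <-].
have [v sv vx] := sP _ (imageP _ x1); exists v => //.
rewrite -(subrK (u t x) v) -addrA (le_lt_trans (rnormD _ _))// [e]splitr ltrD//.
rewrite -bopBE rnormB -bopNE -bopDE.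
rewrite (le_lt_trans (rnorm_bopP _ _))//.
rewrite (@le_lt_trans _ _ (rnorm (f - u t) * 1))//.
  by rewrite ler_wpM2l ?rnorm_ge0.
by rewrite mulr1.
Qed.

End CompactOp.

#[global] Existing Instance totally_filter.

Section SquareSums.
Local Open Scope fset_scope.
Local Open Scope ring_scope.
Local Open Scope complex_scope.
Variables (R : realType) (H : hilbertType R).
Local Notation BH := (bounded_op H).

(* Norm convergence in the C*-algebra B_0(H), whose norm is that of B(H): the
   limit is itself required to be compact. *)
Definition cvg_in_B0 (F : set_system BH) := exists2 S, compact_op S & F --> S.

(* The net of the sums of x_j^* x_j over the finite subsets of Z. Its terms are
   positive, so its convergence is that of the partial sums over [-N, N]. *)
Definition gram_sum (x : int -> BH) : {fset int} -> BH :=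
  partial_sum (fun j => adj (x j) * x j).

Definition qsum (x : int -> BH) (F : {fset int}) (h : H) : R :=
  \sum_(j <- F) rnorm (x j h) ^+ 2.

Implicit Types (x y : int -> BH) (F G : {fset int}) (h k : H).

Lemma gram_sumE x F : gram_sum x F = \sum_(j <- F) adj (x j) * x j.
Proof.
by rewrite /gram_sum /partial_sum -(big_seq_fsetE _ F predT (fun j => adj (x j) * x j)).
Qed.

Lemma reip_gram x F h k :
  reip (gram_sum x F h) k = \sum_(j <- F) reip (x j h) (x j k).
Proof.
rewrite gram_sumE bop_sumE reip_suml; apply: eq_bigr => j _.
by rewrite reipC /reip bopME -adjP -!/(reip _ _) reipC.
Qed.

Lemma qsumE x F h : qsum x F h = reip (gram_sum x F h) h.
Proof. by rewrite reip_gram; apply: eq_bigr => j _; rewrite reip_norm. Qed.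

Lemma qsum_ge0 x F h : 0 <= qsum x F h.
Proof. by apply: sumr_ge0 => j _; exact: sqr_ge0. Qed.

Lemma qsum_le_gram x F h : qsum x F h <= rnorm (gram_sum x F) * rnorm h ^+ 2.
Proof.
rewrite qsumE (le_trans (reip_le _ _))// expr2 mulrA ler_wpM2r ?rnorm_ge0//.
exact: rnorm_bopP.
Qed.

Lemma gram_le x F c : 0 <= c -> (forall h, qsum x F h <= c * rnorm h ^+ 2) ->
  rnorm (gram_sum x F) <= c.
Proof.
move=> c0 qc.
suff key d : 0 < d -> (forall h, qsum x F h <= d * rnorm h ^+ 2) ->
    rnorm (gram_sum x F) <= d.
  apply/ler_addgt0Pr => e e0; apply: key => [|h]; first by rewrite ltr_wpDl.
  rewrite (le_trans (qc h))// ler_wpM2r ?sqr_ge0//; lra.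
move=> d0 qd; apply: rnorm_bop_le => [|h]; first exact: ltW.
set k := gram_sum x F h.
have : 2 * d * rnorm k ^+ 2 <= d ^+ 2 * qsum x F h + qsum x F k.
  rewrite -reip_norm {1}/k reip_gram !mulr_sumr -big_split/=.
  apply: ler_sum => j _; have := reip_le (x j h) (x j k).
  have := sqr_ge0 (d * rnorm (x j h) - rnorm (x j k)).
  move: (reip _ _) (rnorm _) (rnorm _) => u v w; nra.
have := qd h; have := qd k.
have k0 := rnorm_ge0 k; have h0 := rnorm_ge0 h.
move: (qsum _ _ _) (qsum _ _ _) => u v uk vh le1.
have le2 : d * rnorm k ^+ 2 <= d * (d * rnorm h) ^+ 2 by nra.
rewrite ler_pM2l// in le2.
by rewrite -(@ler_pXn2r _ 2)// nnegrE// mulr_ge0// ltW.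
Qed.

Lemma qsum_subset x F G h : F `<=` G -> qsum x F h <= qsum x G h.
Proof.
move=> FG; rewrite /qsum (big_fsetID _ (mem F) G)/= -[leLHS]addr0.
apply: lerD; last by apply: sumr_ge0 => j _; exact: sqr_ge0.
rewrite le_eqVlt; apply/orP; left; apply/eqP; apply: eq_fbigl => j.
rewrite !inE/=; case: (boolP (j \in F)); last by rewrite andbF.
by move/(fsubsetP FG) => ->.
Qed.

Lemma gram_sumD x F G : F `<=` G -> gram_sum x G - gram_sum x F = gram_sum x (G `\` F).
Proof.
move=> FG; rewrite !gram_sumE (big_fsetID _ (mem F) G)/=.
have -> : [fset j in G | mem F j] = F.
  apply/fsetP => j; rewrite !inE/=; case: (boolP (j \in F)); last by rewrite andbF.
  by move/(fsubsetP FG) => ->.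
rewrite addrAC subrr add0r; apply: eq_fbigl => j; rewrite !inE/=.
by rewrite andbC.
Qed.

(* Cauchy criterion for [gram_sum], in terms of quadratic forms. *)
Definition qtail x := forall e : R, 0 < e ->
  exists F, forall G h, qsum x (G `\` F) h <= e * rnorm h ^+ 2.

Lemma totally_near (P : {fset int} -> Prop) F : (forall G, F `<=` G -> P G) ->
  \forall G \near totally, P G.
Proof. by move=> FP; exists F. Qed.

Lemma gram_cvgP x : (forall j, compact_op (x j)) ->
  cvg_in_B0 (gram_sum x @ totally) <-> qtail x.
Proof.
move=> xc; split=> [[S _ /rnorm_cvgP Sx] e e0|tx].
  have e20 : 0 < e / 2 by lra.
  have [F _ FS] := Sx _ e20; exists F => G h.
  have GF : (F `|` G) `\` F = G `\` F by rewrite fsetDUl fsetDv fset0U.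
  rewrite -GF (le_trans (qsum_le_gram _ _ _))// ler_wpM2r ?sqr_ge0//.
  rewrite -gram_sumD ?fsubsetUl// -(subrK S (gram_sum x _)) -addrA.
  rewrite (le_trans (rnormD _ _))// [leRHS]splitr lerD//.
    by rewrite rnormB ltW//; apply: FS; rewrite /= fsubsetUl.
  by rewrite ltW//; apply: FS => /=.
have : cvg (gram_sum x @ totally).
  apply: cauchy_cvg; apply/rnorm_cauchyP => e e0.
  have e20 : 0 < e / 2 by lra.
  have [F FG] := tx _ e20; exists (gram_sum x F); exists F => // G /= sFG.
  rewrite rnormB gram_sumD// (@le_lt_trans _ _ (e / 2))//; last by lra.
  by apply: gram_le => //; exact: ltW.
move=> /cvg_ex[S Sx]; exists S => //.
apply: (@compact_op_lim _ _ _ totally _ (gram_sum x) S) => // F; rewrite gram_sumE; apply: compact_op_sum => j _.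
exact: compact_op_mull.
Qed.

Lemma qsum_lim x S F h : gram_sum x @ totally --> S ->
  qsum x F h <= rnorm S * rnorm h ^+ 2.
Proof.
move=> /rnorm_cvgP Sx; apply/ler_addgt0Pr => e e0.
have d0 : 0 < e / (rnorm h ^+ 2 + 1) by rewrite divr_gt0// ltr_wpDl ?sqr_ge0.
have [G _ GS] := Sx _ d0.
rewrite (le_trans (qsum_subset x h (fsubsetUl F G)))//.
rewrite (le_trans (qsum_le_gram _ _ _))//.
have /ltW : rnorm (S - gram_sum x (F `|` G)) < e / (rnorm h ^+ 2 + 1).
  by apply: GS; rewrite /= fsubsetUr.
rewrite ler_pdivlMr ?ltr_wpDl ?sqr_ge0// => le1.
have := rnormD (gram_sum x (F `|` G) - S) S; rewrite subrK rnormB => le2.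
have := sqr_ge0 (rnorm h); have := rnorm_ge0 (S - gram_sum x (F `|` G)).
move: le1 le2; move: (rnorm _) (rnorm _) (rnorm _) (rnorm h ^+ 2) => u v w q.
nra.
Qed.

Lemma lim_gram_le x S c : gram_sum x @ totally --> S -> 0 <= c ->
  (forall F h, qsum x F h <= c * rnorm h ^+ 2) -> rnorm S <= c.
Proof.
move=> /rnorm_cvgP Sx c0 qc; apply/ler_addgt0Pr => e e0.
have [F /ltW FS] := filter_ex (Sx _ e0).
rewrite -(subrK (gram_sum x F) S) (le_trans (rnormD _ _))// addrC lerD//.
by apply: gram_le.
Qed.

Lemma qsumD x y F h (a b : R) : 0 < a -> 0 < b ->
  qsum (fun j => x j + y j) F h <= (1 + b / a) * qsum x F h + (1 + a / b) * qsum y F h.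
Proof.
move=> a0 b0; rewrite /qsum !mulr_sumr -big_split/=; apply: ler_sum => j _.
have := rnormD (x j h) (y j h); rewrite -bopDE.
have := rnorm_ge0 ((x j + y j) h).
have := rnorm_ge0 (x j h); have := rnorm_ge0 (y j h).
set v := rnorm (y j h); set u := rnorm (x j h); set w := rnorm _ => v0 u0 w0 wuv.
have : w ^+ 2 <= (u + v) ^+ 2 by apply: lerXn2r; rewrite ?nnegrE ?addr_ge0.
move=> /le_trans; apply.
have -> : (1 + b / a) * u ^+ 2 + (1 + a / b) * v ^+ 2 =
    (u + v) ^+ 2 + (b * u - a * v) ^+ 2 / (a * b).
  by field; rewrite !gt_eqF.
by rewrite lerDl divr_ge0 ?sqr_ge0// mulr_ge0 ?ltW.
Qed.

Lemma qtailD x y : qtail x -> qtail y -> qtail (fun j => x j + y j).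
Proof.
move=> tx ty e e0; have e40 : 0 < e / 4 by lra.
have [F FP] := tx _ e40; have [F' FP'] := ty _ e40.
exists (F `|` F') => G h.
rewrite (le_trans (@qsumD x y _ h 1 1 ltr01 ltr01))//.
have := FP (G `\` F') h; have := FP' (G `\` F) h.
rewrite !fsetDDl (fsetUC F' F) => le1 le2.
move: le1 le2; move: (qsum _ _ _) (qsum _ _ _) => u v; lra.
Qed.

Lemma qtail_le x y (c : R) : 0 <= c ->
  (forall j h, rnorm (y j h) <= c * rnorm (x j h)) -> qtail x -> qtail y.
Proof.
move=> c0 yx tx e e0.
have c1 : 0 < c ^+ 2 + 1 by rewrite ltr_wpDl ?sqr_ge0.
have e1 : 0 < e / (c ^+ 2 + 1) by rewrite divr_gt0.
have [F FP] := tx _ e1; exists F => G h.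
have le1 : qsum y (G `\` F) h <= (c ^+ 2 + 1) * qsum x (G `\` F) h.
  rewrite /qsum mulr_sumr; apply: ler_sum => j _.
  rewrite (@le_trans _ _ ((c * rnorm (x j h)) ^+ 2))//.
    by rewrite ler_pXn2r ?nnegrE ?rnorm_ge0// mulr_ge0 ?rnorm_ge0.
  by rewrite exprMn ler_wpM2r ?sqr_ge0// lerDl.
rewrite (le_trans le1)// (le_trans (ler_wpM2l (ltW c1) (FP G h)))//.
by rewrite mulrA (mulrC _ (e / _)) divfK// gt_eqF.
Qed.

Lemma qtail_shift x : qtail x -> qtail (fun j => x (j - 1)).
Proof.
move=> tx e e0; have [F FP] := tx _ e0.
exists [fset j + 1 | j in F] => G h.
have := FP [fset j - 1 | j in G] h; apply: le_trans.
have -> : [fset j - 1 | j in G] `\` F = [fset j - 1 | j in G `\` [fset j + 1 | j in F]].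
  apply/fsetP => j; apply/idP/idP.
    rewrite inE => /andP[jF /imfsetP[/= i iG ji]]; apply/imfsetP; exists i => //=.
    rewrite inE iG andbT; apply/imfsetP => -[k/= kF ik].
    by move: jF; rewrite ji ik addrK kF.
  move=> /imfsetP[/= i]; rewrite inE => /andP[iF iG] ->.
  rewrite inE; apply/andP; split; last by apply/imfsetP; exists i.
  apply: contra iF => iF.
  by apply/imfsetP; exists (i - 1) => //=; rewrite subrK.
rewrite /qsum le_eqVlt; apply/orP; left; apply/eqP/esym.
by apply: big_imfset => i j _ _; exact: addIr.
Qed.

End SquareSums.

(* The right Hilbert module ell_2(B_0(H)), indexed by Z. *)
Record ell2 (R : realType) (H : hilbertType R) := Ell2 {
  ell2_seq :> int -> bounded_op H;
  ell2_compact : forall j, compact_op (ell2_seq j);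
  ell2_cvg : cvg_in_B0 (gram_sum ell2_seq @ totally) }.

Section Ell2.
Local Open Scope fset_scope.
Local Open Scope ring_scope.
Local Open Scope complex_scope.
Variables (R : realType) (H : hilbertType R).
Local Notation BH := (bounded_op H).
Local Notation E := (ell2 H).

HB.instance Definition _ := gen_eqMixin E.
HB.instance Definition _ := gen_choiceMixin E.

Lemma ell2P (x y : E) : (forall j, x j = y j) <-> x = y.
Proof.
split=> [|->//]; case: x y => [f lf bf] [g lg bg] /= /funext fg.
by case: _ / fg in lg bg *; congr Ell2; exact: Prop_irrelevance.
Qed.

Lemma ell2_tail (x : E) : qtail x.
Proof. by apply/gram_cvgP; [exact: ell2_compact|exact: ell2_cvg]. Qed.

Definition mk_ell2 (x : int -> BH) (xc : forall j, compact_op (x j)) (xt : qtail x) :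
  E := Ell2 xc ((gram_cvgP xc).2 xt).

Fact ell20_tail : qtail (fun _ : int => 0 : BH).
Proof.
move=> e e0; exists fset0 => G h; rewrite /qsum big1 => [|j _]; last by rewrite rnorm0 expr0n.
by rewrite mulr_ge0 ?sqr_ge0 ?(ltW e0).
Qed.
Definition ell20 : E := mk_ell2 (fun=> @compact_op0 R H) ell20_tail.

Definition ell2D (x y : E) : E :=
  mk_ell2 (fun j => compact_opD (ell2_compact x j) (ell2_compact y j))
    (qtailD (ell2_tail x) (ell2_tail y)).

Fact ell2Z_tail (a : R[i]) (x : E) : qtail (fun j => a *: x j).
Proof.
apply: (@qtail_le _ _ x _ (complex.Re `|a|)) (ell2_tail x) => [|j h].
  exact: (rnorm_ge0 (a : R[i]^o)).
by rewrite bopZE rnormZ.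
Qed.
Definition ell2Z (a : R[i]) (x : E) : E :=
  mk_ell2 (fun j => compact_opZ a (ell2_compact x j)) (ell2Z_tail a x).

Fact ell2N_tail (x : E) : qtail (fun j => - x j).
Proof.
apply: (@qtail_le _ _ x _ 1) (ell2_tail x) => [|j h]; first exact: ler01.
by rewrite bopNE rnormN mul1r.
Qed.
Definition ell2N (x : E) : E :=
  mk_ell2 (fun j => compact_opN (ell2_compact x j)) (ell2N_tail x).

Fact ell2DA : associative ell2D.
Proof. by move=> f g h; apply/ell2P => x /=; rewrite addrA. Qed.
Fact ell2DC : commutative ell2D.
Proof. by move=> f g; apply/ell2P => x /=; rewrite addrC. Qed.
Fact ell20D : left_id ell20 ell2D.
Proof. by move=> f; apply/ell2P => x /=; rewrite add0r. Qed.
Fact ell2ND : left_inverse ell20 ell2N ell2D.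
Proof. by move=> f; apply/ell2P => x /=; rewrite addNr. Qed.
HB.instance Definition _ := GRing.isZmodule.Build E ell2DA ell2DC ell20D ell2ND.

Fact ell2ZA a b (f : E) : ell2Z a (ell2Z b f) = ell2Z (a * b) f.
Proof. by apply/ell2P => x /=; rewrite scalerA. Qed.
Fact ell21Z : left_id 1 ell2Z.
Proof. by move=> f; apply/ell2P => x /=; rewrite scale1r. Qed.
Fact ell2ZDr : right_distributive ell2Z +%R.
Proof. by move=> a f g; apply/ell2P => x /=; rewrite scalerDr. Qed.
Fact ell2ZDl (f : E) : {morph ell2Z^~ f : a b / a + b}.
Proof. by move=> a b; apply/ell2P => x /=; rewrite scalerDl. Qed.
HB.instance Definition _ :=
  GRing.Zmodule_isLmodule.Build R[i] E ell2ZA ell21Z ell2ZDr ell2ZDl.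

Definition ell2_ip (x y : E) : BH :=
  lim (partial_sum (fun j => adj (x j) * y j) @ totally).

Definition ell2_norm (x : E) : R := Num.sqrt (rnorm (ell2_ip x x)).

Lemma ell2_ip_cvg (x : E) : gram_sum x @ totally --> ell2_ip x x.
Proof. by have [S _ xS] := ell2_cvg x; apply: cvgP xS. Qed.

Lemma ell2_norm_ge0 (x : E) : 0 <= ell2_norm x.
Proof. exact: sqrtr_ge0. Qed.

Lemma ell2_normP (x : E) (c : R) : 0 <= c ->
  ell2_norm x <= c <-> forall F h, qsum x F h <= c ^+ 2 * rnorm h ^+ 2.
Proof.
move=> c0.
have -> : (ell2_norm x <= c) = (rnorm (ell2_ip x x) <= c ^+ 2).
  rewrite -(@ler_pXn2r _ 2) ?nnegrE ?ell2_norm_ge0// sqr_sqrtr//.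
  exact: rnorm_ge0.
split=> [xc F h|qc].
  rewrite (le_trans (qsum_lim F h (@ell2_ip_cvg x)))// ler_wpM2r ?sqr_ge0//.
exact: lim_gram_le (@ell2_ip_cvg x) (sqr_ge0 c) qc.
Qed.

Fact ell2_normD (x y : E) :
  (ell2_norm (x + y))%:C <= (ell2_norm x)%:C + (ell2_norm y)%:C.
Proof.
rewrite -rmorphD lecR; apply/ler_addgt0Pr => e e0.
pose a := ell2_norm x + e / 2; pose b := ell2_norm y + e / 2.
have x0 := ell2_norm_ge0 x; have y0 := ell2_norm_ge0 y.
have a0 : 0 < a by rewrite /a; lra.
have b0 : 0 < b by rewrite /b; lra.
have -> : ell2_norm x + ell2_norm y + e = a + b by rewrite /a /b; field.
apply/ell2_normP => [|F h]; first by rewrite addr_ge0 ?ltW.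
have ax : ell2_norm x <= a by rewrite /a; lra.
have yb : ell2_norm y <= b by rewrite /b; lra.
rewrite (le_trans (@qsumD _ _ x y F h _ _ a0 b0))//.
move: ax => /(ell2_normP _ (ltW a0))/(_ F h) qx.
move: yb => /(ell2_normP _ (ltW b0))/(_ F h) qy.
have ba : 0 <= 1 + b / a by rewrite addr_ge0// divr_ge0 ?ltW.
have ab : 0 <= 1 + a / b by rewrite addr_ge0// divr_ge0 ?ltW.
rewrite (le_trans (lerD (ler_wpM2l ba qx) (ler_wpM2l ab qy)))//.
rewrite le_eqVlt; apply/orP; left; apply/eqP.
by field; rewrite !gt_eqF.
Qed.

Fact ell2_normZ (a : R[i]) (x : E) :
  (ell2_norm (a *: x))%:C = `|a| * (ell2_norm x)%:C.
Proof.
have re0 (b : R[i]) : 0 <= complex.Re `|b| by exact: (rnorm_ge0 (b : R[i]^o)).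
have nZ b (y : E) : ell2_norm (b *: y) <= complex.Re `|b| * ell2_norm y.
  have y0 := ell2_norm_ge0 y.
  apply/ell2_normP => [|F h]; first by rewrite mulr_ge0.
  have := lexx (ell2_norm y) => /(ell2_normP _ y0)/(_ F h) qy.
  rewrite exprMn -mulrA (le_trans _ (ler_wpM2l (sqr_ge0 _) qy))//.
  rewrite /qsum mulr_sumr; apply: ler_sum => j _.
  by rewrite -exprMn -rnormZ.
have -> : `|a| = (complex.Re `|a|)%:C by rewrite RRe_real ?normr_real.
rewrite -rmorphM; congr (_%:C); apply/eqP; rewrite eq_le nZ andTb.
have [->|a0] := eqVneq a 0; first by rewrite normr0 mul0r ell2_norm_ge0.
have a1 : 0 < complex.Re `|a|.
  by rewrite -ltcR RRe_real ?normr_real// normr_gt0.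
rewrite mulrC -ler_pdivlMr// mulrC.
have := nZ a^-1 (a *: x); rewrite scalerA mulVf// scale1r => /le_trans; apply.
rewrite normfV ler_wpM2r ?ell2_norm_ge0//.
suff -> : complex.Re `|a|^-1 = (complex.Re `|a|)^-1 by [].
by apply: complexI; rewrite fmorphV !RRe_real ?normr_real//.
Qed.

Fact ell2_norm0_eq0 (x : E) : (ell2_norm x)%:C = 0 -> x = 0.
Proof.
move=> /complexI x0; apply/ell2P => j; apply/bopP => h.
have : ell2_norm x <= 0 by rewrite x0.
move=> /(ell2_normP _ (lexx 0))/(_ [fset j] h).
rewrite /qsum big_seq_fset1 expr0n mul0r => le0.
apply/rnorm0_eq0/eqP; rewrite -sqrf_eq0.
by rewrite eq_le le0 sqr_ge0.
Qed.

HB.instance Definition _ :=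
  Lmodule_isNormed.Build R[i] E ell2_normD ell2_normZ ell2_norm0_eq0.

Lemma rnorm_ell2 (x : E) : rnorm x = ell2_norm x. Proof. by []. Qed.

Definition uniformly_bounded (W : int -> BH) :=
  exists M : R, forall j, rnorm (W j) <= M.

Fact weighted_shift_tail (W : int -> BH) : uniformly_bounded W ->
  forall x : E, qtail (fun n => W n * x (n - 1)).
Proof.
move=> [M WM] x; apply: (@qtail_le _ _ (fun n => x (n - 1)) _ M).
- by rewrite (le_trans _ (WM 0))// rnorm_ge0.
- move=> j h; rewrite bopME (le_trans (rnorm_bopP _ _))//.
  by rewrite ler_wpM2r ?rnorm_ge0.
- exact/qtail_shift/ell2_tail.
Qed.

(* (T_W x)_n = W_n x_{n-1}; [mk_ell2] packs this sequence with the proof that it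
   belongs to ell_2(B_0(H)). *)
Definition weighted_shift (W : int -> BH) (bW : uniformly_bounded W) (x : E) : E :=
  mk_ell2 (fun n => compact_op_mull (W n) (ell2_compact x (n - 1)))
    (weighted_shift_tail bW x).

Lemma weighted_shiftE (W : int -> BH) (bW : uniformly_bounded W) (x : E) n :
  weighted_shift bW x n = W n * x (n - 1).
Proof. by []. Qed.

End Ell2.

Definition linear_span (K : pzRingType) (V : lmodType K) (A : set V) : set V :=
  [set v | exists n (c : 'I_n -> K) (a : 'I_n -> V),
    (forall i, A (a i)) /\ v = \sum_(i < n) c i *: a i].

Section Bases.
Variables (R : realType) (H : hilbertType R).

Definition orthonormal_basis (e : int -> H) :=
  (forall i j, ip (e i) (e j) = (i == j)%:R) /\ dense (linear_span (range e)).

(* The subspace L_m. *)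
Definition basis_section (e : int -> H) (m : nat) : set H :=
  linear_span (e @` [set i : int | - m%:Z <= i <= m%:Z]).

Definition orthogonal_projection (L : set H) (P : bounded_op H) :=
  forall h, L (P h) /\ forall y, L y -> ip (h - P h) y = 0.

End Bases.

Section Dynamics.
Variables (R : realType) (X : normedModType R[i]) (T : X -> X).

Definition orbit (x : X) : set X := range (fun n => iter n T x).

Definition hypercyclic := exists x, dense (orbit x).

Definition periodic_points : set X :=
  [set x | exists2 n, (0 < n)%N & iter n T x = x].

Definition chaotic := hypercyclic /\ dense periodic_points.

Definition lower_density (A : set nat) : \bar R :=
  limn_einf (fun n =>
    (#|[pred i : 'I_n.+1 | (i : nat) \in A]|%:R / n.+1%:R : R)%:E).

Definition frequently_hypercyclic := exists x, forall O : set X,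
  open O -> O !=set0 -> (0 < lower_density [set n | O (iter n T x)])%E.

Definition topologically_mixing := forall O V : set X,
  open O -> O !=set0 -> open V -> V !=set0 ->
  finite_set (~` [set n | (iter n T @` O) `&` V !=set0]).

(* Every rearrangement of the series converges. *)
Definition unconditionally_convergent (u : nat -> X) :=
  forall s : nat -> nat, bijective s -> cvg (series (u \o s) @ \oo).

Definition frequent_hypercyclicity_criterion :=
  exists (X0 : set X) (S : X -> X),
    [/\ dense X0, forall x, X0 x -> X0 (S x) &
      forall x, X0 x ->
        [/\ unconditionally_convergent (fun n => iter n T x),
            unconditionally_convergent (fun n => iter n S x) & T (S x) = x]].

End Dynamics.

Section OperatorSeries.
Variables (R : realType) (H : hilbertType R).
Implicit Types (D : bounded_op H) (W Winv : int -> bounded_op H).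

(* D^* W_{j+1}^* ... W_{j+n}^* W_{j+n} ... W_{j+1} D *)
Definition forward_term W D (j : int) (n : nat) : bounded_op H :=
  adj D * (\prod_(i < n) adj (W (j + i.+1%:Z)))
        * (\prod_(i < n) W (j + n%:Z - i%:Z)) * D.

(* D^* (W_j^-1)^* ... (W_{j-n+1}^-1)^* W_{j-n+1}^-1 ... W_j^-1 D *)
Definition backward_term Winv D (j : int) (n : nat) : bounded_op H :=
  adj D * (\prod_(i < n) adj (Winv (j - i%:Z)))
        * (\prod_(i < n) Winv (j - n%:Z + i.+1%:Z)) * D.

End OperatorSeries.

(* Main.v *)
Require Import Defs.
From HB Require Import structures.
From mathcomp Require Import all_boot all_order all_algebra finmap.
From mathcomp Require Import complex ring lra zify.
From mathcomp Require Import all_classical all_reals all_analysis.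
From mathcomp.analysis.showcase Require Import summability.
Set Implicit Arguments.
Unset Strict Implicit.
Unset Printing Implicit Defensive.
Import Order.TTheory GRing.Theory Num.Theory numFieldNormedType.Exports.
Local Open Scope classical_set_scope.
Local Open Scope ring_scope.
Local Open Scope complex_scope.

(* (1) => (3): if x has period p then its entry at j + l p is the product of the
   l p weights following j applied to its entry at j, so that for periodic x close
   to the sequence equal to P_m on [J], the series (i) and (ii) are subseries of
   <x, x>. (3) => (2): convergence along the multiples of n_k propagates to all
   powers of T_W because the weights are bounded; hence the T_W-orbit and the
   backward orbit of the vectors supported on [J] with entries D_j y_j are
   unconditionally summable, and such vectors are dense since P_m y_j -> y_j for
   compact y_j. (2) => (1): a vector x of X_0 is approximated by the periodic points
   x + sum_l (S^{l n} x + T^{l n} x), and a frequently hypercyclic vector is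
   sum_n S^{p n} y_{lab n}, where the y_k run through X_0 densely, the indices
   labelled k have positive lower density, and the positions p n are separated
   according to their labels. *)

(** * Unconditional summability *)

Section NormTopology.
Variables (R : realType) (X : normedModType R[i]).
Implicit Types (x y : X) (u v : nat -> X).

(** Estimates on operator sums are made on quadratic forms: a finite sum $\sum_j x_j^*x_j$ has norm
    at most $c$ as soon as $\sum_j\|x_jh\|^2\le c\|h\|^2$ for all $h$. The terms being positive,
    ordinary convergence of (i) and (ii) gives smallness over arbitrary finite sets of late indices,
    which is the unconditional summability that the criterion asks for. The weights multiply from
    the left and the module acts on the right, so a bound for the orbit of $D$ placed at $j$,
    evaluated at the vectors $fh$, is a bound for the orbit of $Df$: this is why (3) need only speak
    of operators near $P_m$. The delicate point of frequent hypercyclicity is that the spacing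
    demanded by a label $k$ may grow arbitrarily fast with $k$, whereas the positions carrying a
    given label must grow at most linearly. *)

Lemma rnorm_sum (I : Type) (r : seq I) (Q : pred I) (F : I -> X) :
  rnorm (\sum_(i <- r | Q i) F i) <= \sum_(i <- r | Q i) rnorm (F i).
Proof.
elim/big_rec2: _ => [|i a b _ ab]; first by rewrite rnorm0.
by rewrite (le_trans (rnormD _ _))// lerD2l.
Qed.

Lemma rnorm_subD z x y : rnorm (x - y) <= rnorm (x - z) + rnorm (z - y).
Proof. by rewrite (le_trans _ (rnormD _ _))// addrA subrK. Qed.

Lemma rnorm_cvgnP u l :
  u @ \oo --> l <->
  forall e : R, 0 < e -> exists N, forall n, (N <= n)%N -> rnorm (l - u n) < e.
Proof.
split=> [/rnorm_cvgP ul e /ul[N _ Ne]|ul]; first by exists N => n; exact: Ne.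
by apply/rnorm_cvgP => e /ul[N Ne]; exists N.
Qed.

Lemma cvg_rnorm_le u l x (c : R) N : u @ \oo --> l ->
  (forall n, (N <= n)%N -> rnorm (u n - x) <= c) -> rnorm (l - x) <= c.
Proof.
move=> /rnorm_cvgnP ul uc; apply/ler_addgt0Pr => e /ul[N' N'e].
rewrite (le_trans (rnorm_subD (u (maxn N N')) _ _))// addrC lerD//.
  by apply: uc; exact: leq_maxl.
by apply/ltW/N'e; exact: leq_maxr.
Qed.

Lemma open_rnorm (O : set X) x : open O -> O x ->
  exists2 e : R, 0 < e & forall y, rnorm (x - y) < e -> O y.
Proof.
move=> oO Ox; have /nbhs_ballP[[a b] /=] := open_nbhs_nbhs (conj oO Ox).
rewrite ltcE/= => /andP[/eqP-> a0] aO; exists a => // y xy; apply: aO.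
by rewrite -/(a%:C) rnorm_ballE.
Qed.

Lemma rnorm_ball_open x (e : R) : 0 < e ->
  exists2 O : set X, open O /\ O x & forall y, O y -> rnorm (x - y) < e.
Proof.
move=> e0; exists (ball x e%:C)° => [|y /interior_subset].
  split; first exact: open_interior.
  by apply: (nbhsx_ballx x); rewrite ltcR.
by rewrite rnorm_ballE.
Qed.

Lemma dense_rnormP (A : set X) : dense A <->
  forall x (e : R), 0 < e -> exists2 a, A a & rnorm (x - a) < e.
Proof.
split=> [dA x e e0|dA O [x Ox] oO].
  have [U [oU Ux] Ue] := rnorm_ball_open x e0.
  by have [|a [Ua Aa]] := dA U _ oU; [exists x|exists a => //; exact: Ue].
have [e e0 eO] := open_rnorm oO Ox.
by have [a Aa xa] := dA x e e0; exists a; split => //; exact: eO.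
Qed.

(* The Cauchy criterion over finite index sets, given as duplicate-free
   sequences. *)
Definition unconditionally_cauchy u := forall e : R, 0 < e -> exists N,
  forall r : seq nat, uniq r -> all (leq N) r -> rnorm (\sum_(i <- r) u i) <= e.

Lemma unconditionally_cauchyD u v :
  unconditionally_cauchy u -> unconditionally_cauchy v ->
  unconditionally_cauchy (fun n => u n + v n).
Proof.
move=> cu cv e e0; have e20 : 0 < e / 2 by lra.
have [N Nu] := cu _ e20; have [N' Nv] := cv _ e20.
exists (maxn N N') => r ur /allP Nr; rewrite big_split (le_trans (rnormD _ _))//.
rewrite [leRHS]splitr lerD// ?Nu ?Nv//; apply/allP => i /Nr/=; rewrite geq_max.
  by case/andP.
by case/andP.
Qed.

Lemma unconditionally_cauchy0 : unconditionally_cauchy (fun=> 0).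
Proof. by move=> e e0; exists 0%N => r _ _; rewrite big1// rnorm0 ltW. Qed.

Lemma unconditionally_cauchy_term u : unconditionally_cauchy u ->
  forall e : R, 0 < e -> exists N, forall n, (N <= n)%N -> rnorm (u n) <= e.
Proof.
move=> cu e /cu[N Nu]; exists N => n Nn.
by have := Nu [:: n]; rewrite big_seq1/= Nn; apply.
Qed.

Lemma unconditionally_cauchy_shift u : unconditionally_cauchy (fun n => u n.+1) ->
  unconditionally_cauchy u.
Proof.
move=> cu e /cu[N Nu]; exists N.+1 => r ur /allP Nr.
have -> : \sum_(i <- r) u i = \sum_(i <- map predn r) u i.+1.
  rewrite big_map; apply: eq_big_seq => i /Nr; by case: i.
apply: Nu.
  rewrite map_inj_in_uniq// => i j /Nr + /Nr; by case: i j => [|i] [|j] //= _ _ ->.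
by apply/allP => _ /mapP[i /Nr + ->]; case: i.
Qed.

(** A property rather than a structure, because [ell2 H] is only equipped as a normed module;
    sequences are enough, since only series are summed in it. *)
Definition sequentially_complete := forall u : nat -> X,
  (forall e : R, 0 < e -> exists N,
    forall m n, (N <= m)%N -> (m <= n)%N -> rnorm (u n - u m) <= e) ->
  exists l : X, u @ \oo --> l.

Lemma seriesB u m n : (m <= n)%N ->
  series u n - series u m = \sum_(i <- index_iota m n) u i.
Proof.
by move=> mn; rewrite !seriesEnat /= (big_cat_nat (n := m))//= addrAC subrr add0r.
Qed.

Lemma big_nat_addl u m n :
  \sum_(m <= i < m + n) u i = \sum_(0 <= i < n) u (i + m)%N.
Proof. by rewrite -{1}[m]add0n big_addn addKn. Qed.

Lemma unconditionally_cauchy_cvg u : sequentially_complete ->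
  unconditionally_cauchy u -> unconditionally_convergent u.
Proof.
move=> cX cu s [t st ts].
have [|l sl] := cX (series (u \o s)); last by apply/cvg_ex; exists l.
(* Past every preimage of an index below [N], the rearranged series only meets indices at least
   [N]. *)
move=> e /cu[N Nu]; exists (\max_(k < N) t k).+1 => m n Nm mn.
rewrite seriesB//.
have -> : \sum_(i <- index_iota m n) (u \o s) i =
    \sum_(i <- map s (index_iota m n)) u i by rewrite big_map.
apply: Nu; first by rewrite map_inj_uniq ?iota_uniq//; exact: can_inj st.
apply/allP => _ /mapP[i + ->]; rewrite mem_index_iota => /andP[mi _].
rewrite /= leqNgt; apply/negP => siN.
have := leq_bigmax (Ordinal siN : 'I_N) (F := fun k : 'I_N => t k).
by rewrite /= st leqNgt (leq_trans Nm mi).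
Qed.

(* Otherwise infinitely many consecutive disjoint intervals each contain a finite
   set over which the sum of [u] is large; permute each interval so as to start
   with that set. *)
Lemma unconditionally_convergent_cauchy u :
  unconditionally_convergent u -> unconditionally_cauchy u.
Proof.
move=> cu; apply: contrapT => /existsNP[e /not_implyP[e0 /forallNP eN]].
have /choice[r rP] : forall N, exists r : seq nat,
    [/\ uniq r, all (leq N) r & e < rnorm (\sum_(i <- r) u i)].
  move=> N; have /existsNP[r /not_implyP[ur /not_implyP[Nr /negP]]] := eN N.
  by rewrite -ltNge; exists r.
(* [f N] lies beyond [N] and all of [r N], so the blocks [[B k, B k.+1[] partition the indices and
   block [k] contains [r (B k)]. *)
pose f N := (maxn N (\max_(i <- r N) i)).+1.
pose B k := iter k f 0%N.
have BS k : (B k < B k.+1)%N by rewrite /= ltnS leq_maxl.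
have Bmono : {homo B : k k' / (k < k')%N}.
  by apply: homo_ltn => // j i k; exact: ltn_trans.
have Bmono' : {homo B : k k' / (k <= k')%N}.
  by move=> k k'; rewrite leq_eqVlt => /orP[/eqP->//|/Bmono/ltnW].
have Bge k : (k <= B k)%N by elim: k => // k IH; exact: leq_ltn_trans IH (BS k).
have /choice[b bP] : forall i, exists k, (B k <= i < B k.+1)%N.
  elim=> [|i [k /andP[Bi iB]]]; first by exists 0%N.
  have [iB'|iB'] := ltnP i.+1 (B k.+1); first by exists k; rewrite iB' (leqW Bi).
  have -> : i.+1 = B k.+1 by apply/eqP; rewrite eqn_leq iB' iB.
  by exists k.+1; rewrite leqnn BS.
have b_uniq i k : (B k <= i < B k.+1)%N -> b i = k.
  move=> /andP[ki ik]; have /andP[bi ib] := bP i.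
  have [bk|kb|//] := ltngtP (b i) k.
    by have := leq_trans ib (leq_trans (Bmono' _ _ bk) ki); rewrite ltnn.
  by have := leq_trans ik (leq_trans (Bmono' _ _ kb) bi); rewrite ltnn.
pose L k := r (B k) ++ [seq i <- index_iota (B k) (B k.+1) | i \notin r (B k)].
have rB k i : i \in r (B k) -> (B k <= i < B k.+1)%N.
  have [_ /allP Br _] := rP (B k); move=> ir; rewrite (Br _ ir)/= ltnS.
  rewrite leq_max; apply/orP; right.
  by rewrite (bigD1_seq i) ?leq_maxl//=; have [] := rP (B k).
have L_perm k : perm_eq (L k) (index_iota (B k) (B k.+1)).
  apply: uniq_perm; last 2 first.
  - exact: iota_uniq.
  - move=> i; rewrite mem_cat mem_filter mem_index_iota.
    by case: (boolP (i \in r (B k))) => //= /rB ->.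
  rewrite cat_uniq filter_uniq ?iota_uniq ?andbT//; have [-> _ _] := rP (B k).
  by apply/hasPn => i; rewrite mem_filter => /andP[].
have L_uniq k : uniq (L k) by rewrite (perm_uniq (L_perm k)) iota_uniq.
have L_size k : size (L k) = (B k.+1 - B k)%N by rewrite (perm_size (L_perm k)) size_iota.
have L_mem k i : (i \in L k) = (B k <= i < B k.+1)%N.
  by rewrite (perm_mem (L_perm k)) mem_index_iota.
(* [s] runs through each block in the order [L]; it maps the block onto itself, and [t] is its
   inverse there. *)
pose s i := nth 0%N (L (b i)) (i - B (b i)).
pose t i := (B (b i) + index i (L (b i)))%N.
have ltL i : (i - B (b i) < size (L (b i)))%N.
  have /andP[bi ib] := bP i.
  by rewrite L_size ltn_sub2r// (leq_ltn_trans bi).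
have bs i : b (s i) = b i by apply: b_uniq; rewrite -L_mem mem_nth.
have bt i : b (t i) = b i.
  apply: b_uniq; rewrite leq_addr/= -ltn_subRL -L_size index_mem L_mem.
  exact: bP.
have s_bij : bijective s.
  exists t => i.
    rewrite /t bs index_uniq// subnKC//; by have /andP[] := bP i.
  by rewrite /s bt /t addKn nth_index// L_mem.
have /rnorm_cvgnP/(_ (e / 2)) := cu _ s_bij.
have e20 : 0 < e / 2 by lra.
move=> /(_ e20)[N Ne].
(* The sum over [r (B N)] is a difference of two partial sums of the rearrangement taken past [N],
   hence at most [e], a contradiction. *)
have [_ _] := rP (B N); apply/negP; rewrite -leNgt.
have rL : (B N + size (r (B N)) <= B N.+1)%N.
  by rewrite -leq_subRL ?(ltnW (BS _))// -L_size size_cat leq_addr.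
have -> : \sum_(i <- r (B N)) u i =
    series (u \o s) (B N + size (r (B N)))%N - series (u \o s) (B N).
  rewrite seriesB ?leq_addr// (big_nth 0%N) big_nat_addl.
  apply: eq_big_nat => i /andP[_ ir].
  have bi : b (i + B N)%N = N.
    by apply: b_uniq; rewrite leq_addl/= (leq_trans _ rL)// addnC ltn_add2l.
  by rewrite /= /s bi addnK /L nth_cat ir.
rewrite (le_trans (rnorm_subD (lim (series (u \o s) @ \oo)) _ _))//.
rewrite [leRHS]splitr lerD//; last by apply/ltW/Ne/Bge.
by rewrite rnormB; apply/ltW/Ne; rewrite (leq_trans (Bge N))// leq_addr.
Qed.

End NormTopology.

(** * Separated sets of positive lower density *)

(** The sum is the valuation of $n!$, which is $\sum_k\lfloor n/2^k\rfloor$ by Legendre's formula.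
    Carrying the remainder $\lfloor n/2^K\rfloor$ makes the bound inductive, because $2\lfloor
    a/2\rfloor\le a$. *)
Lemma sum_logn2 n : (\sum_(i < n) logn 2 i.+1 <= n)%N.
Proof.
have -> : (\sum_(i < n) logn 2 i.+1 = logn 2 n`!)%N.
  elim: n => [|n IH]; first by rewrite big_ord0 logn1.
  by rewrite big_ord_recr/= IH factS lognM ?fact_gt0// addnC.
rewrite logn_fact//.
suff : forall K, (\sum_(1 <= k < K.+1) n %/ 2 ^ k + n %/ 2 ^ K <= n)%N.
  by move=> /(_ n); apply: leq_trans; exact: leq_addr.
elim=> [|K IH]; first by rewrite big_geq// divn1.
apply: leq_trans IH; rewrite big_nat_recr//= -addnA leq_add2l.
rewrite expnSr divnMA addnn -muln2; exact: leq_trunc_div.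
Qed.

(** As [b] varies, these are all the positive integers of valuation [a]: an explicit infinite
    family, spaced regularly. *)
Lemma logn2_odd_mul a b : logn 2 (2 ^ a * b.*2.+1) = a.
Proof.
rewrite lognM ?expn_gt0// pfactorK// lognE/= dvdn2/= odd_double.
by rewrite addn0.
Qed.

(* The label of [n] is read off the 2-adic valuation [v] of [n + 1], which is at
   most 1 on average; labels [k] with [N k] larger than [v] are replaced by 0, so
   that the spacings [N (lab n)] are bounded on average. *)
Lemma separated_labelling (N : nat -> nat) : exists lab p : nat -> nat,
  [/\ forall m n, (m < n)%N -> (N (lab m) + p m < p n)%N /\ (N (lab n) + p m < p n)%N,
      forall n, (n <= p n)%N /\ (N (lab n) <= p n)%N &
      forall k, exists K (f : nat -> nat),
        injective f /\ forall t, lab (f t) = k /\ (p (f t) <= K * t.+1)%N].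
Proof.
(* The label is a valuation of a valuation: each [k] then comes from infinitely many [v], in
   particular from some [v] at least [N k], where it is not replaced by 0. *)
pose phi v := if (N (logn 2 v.+1) <= v)%N then logn 2 v.+1 else 0%N.
pose lab n := phi (logn 2 n.+1).
pose w n := (N (lab n)).+1.
(* Each index owns an interval of radius [w n] centred at [p n], and consecutive intervals abut. *)
pose p n := (\sum_(i < n) (w i).*2 + w n)%N.
have wle n : (w n <= logn 2 n.+1 + (N 0%N).+1)%N.
  rewrite /w /lab /phi; case: ifP => [Nv|_]; last by rewrite leq_addl.
  by rewrite addnS ltnS (leq_trans Nv)// leq_addr.
have pS n : p n.+1 = (p n + w n + w n.+1)%N.
  by rewrite /p big_ord_recr/= -addnn addnA.
have pD m n : (m < n)%N -> (p m + w m + w n <= p n)%N.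
  elim: n => // n IH; rewrite ltnS leq_eqVlt => /orP[/eqP->|/IH mn].
    by rewrite pS.
  rewrite pS leq_add2r (leq_trans (leq_trans _ mn))//; first exact: leq_addr.
  exact: leq_addr.
exists lab, p; split=> [m n /pD mn|n|k].
- by move: mn; rewrite /w; lia.
- split; last by rewrite (@leq_trans (w n))// leq_addl.
  elim: n => // n IH; rewrite pS addnS ltnS (leq_trans IH)//.
  by rewrite -addnA leq_addr.
pose v := (2 ^ k * (N k).*2.+1).-1.
have vS : v.+1 = (2 ^ k * (N k).*2.+1)%N by rewrite prednK// muln_gt0 expn_gt0.
have phiv : phi v = k.
  rewrite /phi vS logn2_odd_mul ifT// -ltnS vS.
  rewrite (@leq_trans (N k).*2.+1)// ?leq_pmull ?expn_gt0//.
  by rewrite ltnS -addnn leq_addr.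
pose f t := (2 ^ v * t.*2.+1).-1.
have fS t : (f t).+1 = (2 ^ v * t.*2.+1)%N by rewrite prednK// muln_gt0 expn_gt0.
(* The constant combines $p_n\le 2(N_0+2)(n+1)$, which holds since valuations average at most 1,
   with $f(t)+1=2^v(2t+1)\le 2^{v+1}(t+1)$. *)
exists (4 * ((N 0%N).+2 * 2 ^ v))%N, f; split=> [s t st|t].
  have := fS s; rewrite st fS => /eqP; rewrite eqn_pmul2l ?expn_gt0// eqSS.
  by move/eqP/double_inj.
split; first by rewrite /lab fS logn2_odd_mul.
have ple n : (p n <= 2 * ((N 0%N).+2 * n.+1))%N.
  rewrite (@leq_trans (\sum_(i < n.+1) (w i).*2))//.
    by rewrite big_ord_recr/= leq_add2l -addnn leq_addr.
  have -> : (\sum_(i < n.+1) (w i).*2 = 2 * \sum_(i < n.+1) w i)%N.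
    by rewrite big_distrr/=; apply: eq_bigr => i _; rewrite -mul2n.
  rewrite leq_mul2l/= mulSn.
  apply: (@leq_trans (\sum_(i < n.+1) (logn 2 i.+1 + (N 0%N).+1))).
    by apply: leq_sum => i _; exact: wle.
  rewrite big_split/= sum_nat_const card_ord leq_add ?sum_logn2//.
  by rewrite mulnC.
rewrite (leq_trans (ple _))// fS (mulnA (N 0%N).+2).
move: ((N 0%N).+2 * 2 ^ v)%N => A; nia.
Qed.

Section LowerDensity.
Variable R : realType.

Lemma limn_einf_gt0 (u : nat -> \bar R) (c : R) K : 0 < c ->
  (forall n, (K <= n)%N -> (c%:E <= u n)%E) -> (0 < limn_einf u)%E.
Proof.
move=> c0 cu; rewrite limn_einf_lim (cvg_lim _ (@cvg_einfs_sup _ u))//.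
apply: (@lt_le_trans _ _ c%:E); first by rewrite lte_fin.
apply: (@le_trans _ _ (einfs u K)); last by apply: ereal_sup_ubound; exists K.
by apply: le_ereal_inf_tmp => _ [n /= Kn <-]; exact: cu.
Qed.

(** With $q=\lfloor n/K\rfloor$, the values $g(0),\dots,g(q-1)$ are distinct elements of $A$ in
    $[0,n]$, and $n+1\le (q+1)K\le 2Kq$ once $q\ge 1$; hence the bound $1/(2K)$. *)
Lemma lower_density_gt0 (A : set nat) (g : nat -> nat) K :
  injective g -> (forall t, A (g t) /\ (g t <= K * t.+1)%N) ->
  (0 < lower_density R A)%E.
Proof.
move=> g_inj gA.
have K0 : (0 < K)%N.
  rewrite lt0n; apply/eqP => K0.
  have g0 t : g t = 0%N by apply/eqP; have [_] := gA t; rewrite K0 mul0n leqn0.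
  by have := g_inj 0%N 1%N; rewrite !g0 => /(_ erefl).
apply: (@limn_einf_gt0 _ ((2 * K)%:R^-1) K).
  by rewrite invr_gt0 ltr0n muln_gt0.
move=> n Kn; rewrite lee_fin; set q := (n %/ K)%N.
have q0 : (0 < q)%N by rewrite divn_gt0.
have gn (t : 'I_q) : (g t < n.+1)%N.
  rewrite ltnS (leq_trans (gA t).2)// (@leq_trans (K * q))%N//.
    by rewrite leq_mul2l ltn_ord orbT.
  by rewrite mulnC leq_trunc_div.
have qA : (q <= #|[pred i : 'I_n.+1 | (i : nat) \in A]|)%N.
  have h_inj : injective (fun t : 'I_q => Ordinal (gn t)).
    by move=> s t [] /g_inj/val_inj.
  rewrite -[leqLHS](card_ord q) -(fintype.card_image h_inj 'I_q).
  apply/subset_leq_card/fintype.subsetP => _ /fintype.imageP[t _ ->].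
  by rewrite inE; exact: (gA t).1.
rewrite ler_pdivlMr ?ltr0n// mulrC ler_pdivrMr ?ltr0n ?muln_gt0//.
rewrite -natrM ler_nat (@leq_trans (q * (2 * K)))//; last by rewrite leq_mul2r qA orbT.
rewrite (@leq_trans (q.+1 * K))// ?ltn_ceil//.
by rewrite mulnA leq_mul2r muln2 -addnn -addn1 leq_add2l q0 orbT.
Qed.

End LowerDensity.

(** * Consequences of the Frequent Hypercyclicity Criterion *)

Section FrequentHypercyclicityCriterion.
Variables (R : realType) (X : normedModType R[i]).
Local Notation w := (fun k : nat => (2^-1 : R) ^+ k).

Lemma unconditionally_cauchy_subseq (u : nat -> X) (f : nat -> nat) :
  unconditionally_cauchy u -> injective f -> (forall n, (n <= f n)%N) ->
  unconditionally_cauchy (u \o f).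
Proof.
move=> cu f_inj fge e /cu[N Nu]; exists N => r ur /allP Nr.
have -> : \sum_(i <- r) (u \o f) i = \sum_(i <- map f r) u i by rewrite big_map.
apply: Nu; first by rewrite map_inj_uniq.
by apply/allP => _ /mapP[i /Nr /= Ni ->]; exact: leq_trans Ni (fge i).
Qed.

Lemma geometric_sum_lt (K : nat) : \sum_(k < K) w k = 2 - 2 * w K.
Proof.
elim: K => [|K IH]; first by rewrite big_ord0 expr0; lra.
by rewrite big_ord_recr/= IH exprS; lra.
Qed.

(* A term labelled [k] with index at least [max (N k) (N j)] costs
   [4 ^- max k j <= 2 ^- k * 2 ^- j]. *)
Lemma rnorm_labelled_sum (u : nat -> nat -> X) (N lab d : nat -> nat)
    (r : seq nat) j :
  (forall k l s, (k <= l)%N -> uniq s -> all (leq (N l)) s ->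
    rnorm (\sum_(i <- s) u k i) <= w l * w l) ->
  uniq r -> {in r &, injective d} ->
  (forall n, n \in r -> (N j <= d n)%N /\ (N (lab n) <= d n)%N) ->
  rnorm (\sum_(n <- r) u (lab n) (d n)) <= 2 * w j.
Proof.
move=> uN ur d_inj Nd.
have w0 k : 0 <= w k by rewrite exprn_ge0.
have wle k l : (k <= l)%N -> w l <= w k.
  by move=> kl; apply: ler_wiXn2l => //; lra.
have step K : rnorm (\sum_(n <- r | (lab n < K)%N) u (lab n) (d n)) <=
    (\sum_(k < K) w k) * w j.
  elim: K => [|K IH].
    by rewrite big_pred0// rnorm0 big_ord0 mul0r.
  rewrite (bigID (fun n => lab n == K))/= big_ord_recr/= mulrDl addrC.
  rewrite (le_trans (rnormD _ _))// lerD//.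
    congr (_ <= _): IH; congr rnorm; apply: eq_bigl => n.
    by rewrite ltnS ltn_neqAle andbC.
  have -> : \sum_(n <- r | (lab n < K.+1)%N && (lab n == K)) u (lab n) (d n) =
      \sum_(i <- [seq d n | n <- r & lab n == K]) u K i.
    rewrite big_map big_filter; apply: eq_big => [n|n /andP[_ /eqP->//]].
    by case: eqP => [->|]; rewrite ?ltnSn ?andbF.
  apply: (@le_trans _ _ (w (maxn K j) * w (maxn K j))).
    apply: uN; first exact: leq_maxl.
      rewrite map_inj_in_uniq ?filter_uniq// => m n.
      by rewrite !mem_filter => /andP[_ mr] /andP[_ nr]; exact: d_inj.
    apply/allP => _ /mapP[n + ->]; rewrite mem_filter => /andP[/eqP <- /Nd[]].
    by rewrite /maxn; case: ifP.
  by apply: ler_pM; rewrite ?w0// wle ?leq_maxl ?leq_maxr.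
have -> : \sum_(n <- r) u (lab n) (d n) =
    \sum_(n <- r | (lab n < (\max_(n <- r) lab n).+1)%N) u (lab n) (d n).
  rewrite [RHS]big_mkcond; apply: eq_big_seq => n nr.
  by rewrite ltnS (bigD1_seq n)//= leq_maxl.
rewrite (le_trans (step _))// ler_wpM2r// geometric_sum_lt.
by have := w0 (\max_(n <- r) lab n).+1; lra.
Qed.

Variables (T : {linear X -> X}) (M : R).
Hypotheses (M0 : 0 <= M) (TM : forall x, rnorm (T x) <= M * rnorm x).

Lemma iterlB n x y : iter n T (x - y) = iter n T x - iter n T y.
Proof. by elim: n => //= n ->; rewrite linearB. Qed.

Lemma iterlD n x y : iter n T (x + y) = iter n T x + iter n T y.
Proof. by elim: n => //= n ->; rewrite linearD. Qed.

Lemma iterl_sum n (r : seq nat) (u : nat -> X) :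
  iter n T (\sum_(i <- r) u i) = \sum_(i <- r) iter n T (u i).
Proof.
elim: r => [|i r IH]; last by rewrite !big_cons iterlD IH.
by rewrite !big_nil; elim: n => //= n ->; rewrite linear0.
Qed.

Lemma rnorm_iterl n x : rnorm (iter n T x) <= M ^+ n * rnorm x.
Proof.
elim: n => [|n IH]; first by rewrite expr0 mul1r.
by rewrite /= (le_trans (TM _))// exprS -mulrA ler_wpM2l.
Qed.

Lemma cvg_iterl n (u : nat -> X) l : u @ \oo --> l ->
  (fun k => iter n T (u k)) @ \oo --> iter n T l.
Proof.
move=> /rnorm_cvgnP ul; apply/rnorm_cvgnP => e e0.
have Mn0 : 0 < M ^+ n + 1 by rewrite ltr_wpDl ?exprn_ge0.
have [N Ne] := ul (e / (M ^+ n + 1)) (divr_gt0 e0 Mn0).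
exists N => k /Ne; rewrite ltr_pdivlMr// => le1.
rewrite -iterlB (le_lt_trans (rnorm_iterl _ _))// (le_lt_trans _ le1)//.
by rewrite mulrDr mulr1 mulrC lerDl rnorm_ge0.
Qed.

Variables (X0 : set X) (S : X -> X).
Hypotheses (X0_dense : dense X0) (X0_stable : forall x, X0 x -> X0 (S x)).
Hypothesis T_cauchy : forall x, X0 x -> unconditionally_cauchy (fun n => iter n T x).
Hypothesis S_cauchy : forall x, X0 x -> unconditionally_cauchy (fun n => iter n S x).
Hypothesis TS : forall x, X0 x -> T (S x) = x.

Lemma iter_right_inverse n x : X0 x -> X0 (iter n S x) /\ iter n T (iter n S x) = x.
Proof.
move=> x0; elim: n => [//|n [Sn TSn]]; split; first exact: X0_stable.
by rewrite iterSr/= TS.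
Qed.

Lemma iter_right_inverse_ge m n x : X0 x -> (m <= n)%N ->
  iter m T (iter n S x) = iter (n - m) S x.
Proof.
move=> x0 mn; rewrite -{1}(subnKC mn) iterD.
by have [xs _] := iter_right_inverse (n - m) x0; have [_] := iter_right_inverse m xs.
Qed.

Lemma iter_right_inverse_le m n x : X0 x -> (n <= m)%N ->
  iter m T (iter n S x) = iter (m - n) T x.
Proof.
move=> x0 nm; rewrite -{1}(subnK nm) iterD.
by have [_ ->] := iter_right_inverse n x0.
Qed.

(** For large $n$ the vector $x'+S^ny'$ is close to $x'$, and its image $T^nx'+y'$ is close to
    $y'$. *)
Lemma criterion_mixing : topologically_mixing T.
Proof.
move=> U V oU [x Ux] oV [y Vy].
have [x' [Ux' X0x]] := X0_dense (ex_intro _ x Ux) oU.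
have [y' [Vy' X0y]] := X0_dense (ex_intro _ y Vy) oV.
have [e e0 eU] := open_rnorm oU Ux'; have [d d0 dV] := open_rnorm oV Vy'.
have e20 : 0 < e / 2 by lra.
have d20 : 0 < d / 2 by lra.
have [N SN] := unconditionally_cauchy_term (S_cauchy X0y) e20.
have [N' TN] := unconditionally_cauchy_term (T_cauchy X0x) d20.
apply: (@sub_finite_set _ _ `I_(maxn N N')); last exact: finite_II.
move=> n /= nUV; rewrite ltnNge geq_max; apply/negP => /andP[Nn N'n]; apply: nUV.
exists (iter n T (x' + iter n S y')); split.
  exists (x' + iter n S y') => //; apply: eU.
  by rewrite opprD addNKr rnormN (le_lt_trans (SN _ Nn))//; lra.
apply: dV; rewrite iterlD; have [_ ->] := iter_right_inverse n X0y.
by rewrite opprD addrC addrNK rnormN (le_lt_trans (TN _ N'n))//; lra.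
Qed.

Hypothesis cX : sequentially_complete X.

Lemma criterion_periodic : dense (periodic_points T).
Proof.
apply/dense_rnormP => x e e0; have e40 : 0 < e / 4 by lra.
have [x' x0 xx'] : exists2 x', X0 x' & rnorm (x - x') < e / 4.
  by move/dense_rnormP: X0_dense => /(_ x _ e40).
have [N TN] := T_cauchy x0 e40; have [N' SN] := S_cauchy x0 e40.
(* All positive multiples of [n] lie past both thresholds, so the correction added to [x'] is small;
   the successor makes the period positive. *)
pose n := (maxn N N').+1.
pose f l := (l.+1 * n)%N.
have f_inj : injective f by move=> l k /eqP; rewrite eqn_pmul2r// => /eqP[].
have fge l : (l <= f l)%N by rewrite (leq_trans (leqnSn l))// leq_pmulr.
pose v l := iter (f l) S x' + iter (f l) T x'.
have cv : unconditionally_cauchy v.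
  apply: unconditionally_cauchyD.
    exact: (unconditionally_cauchy_subseq (S_cauchy x0) f_inj fge).
  exact: (unconditionally_cauchy_subseq (T_cauchy x0) f_inj fge).
have [z vz] : exists z : X, series v @ \oo --> z.
  have id_bij : bijective (id : nat -> nat) by exists id.
  by have /cvg_ex[z vz] := unconditionally_cauchy_cvg cX cv id_bij; exists z.
have small m : rnorm (series v m) <= e / 2.
  rewrite seriesEnat/= big_split (le_trans (rnormD _ _))// (_ : e / 2 = e / 4 + e / 4); last by lra.
  have uf : uniq (map f (index_iota 0 m)) by rewrite map_inj_uniq ?iota_uniq.
  have nf i : i \in map f (index_iota 0 m) -> (n <= i)%N.
    by move=> /mapP[l _ ->]; rewrite leq_pmull.
  rewrite lerD//.
    have := SN _ uf; rewrite big_map; apply; apply/allP => i /nf.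
    by apply: leq_trans; rewrite leqW// leq_maxr.
  have := TN _ uf; rewrite big_map; apply; apply/allP => i /nf.
  by apply: leq_trans; rewrite leqW// leq_maxl.
exists (x' + z); last first.
  rewrite opprD addrA (le_lt_trans (rnormD _ _))// rnormN.
  suff : rnorm z <= e / 2 by lra.
  by rewrite -(subr0 z); apply: (cvg_rnorm_le vz (N := 0%N)) => m _; rewrite subr0.
exists n => //.
have v0 : series v 0 = 0 by rewrite seriesEnat/= big_geq.
(* $T^n$ moves every term of the two-sided sum by one place, so only the ends differ: $T^{(m+1)n}x'$
   enters and $S^{mn}x'$ leaves. Both tend to 0. *)
have shift m : iter n T (x' + series v m) =
    x' + series v m + (iter (f m) T x' - iter (m * n) S x').
  elim: m => [|m IH].
    by rewrite v0 !addr0 /f mul1n mul0n addrCA subrr addr0.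
  have vE : series v m.+1 = series v m + v m by rewrite !seriesEnat/= big_nat_recr.
  rewrite vE addrA iterlD IH /v iterlD iter_right_inverse_ge ?leq_pmull//.
  rewrite -iterD /f mulSn addKn -mulSn.
  set a := iter (m.+1 * n) T x'; set b := iter (m * n) S x'.
  set c := iter (m.+1 * n) S x'.
  have -> : (n + m.+1 * n = m.+2 * n)%N by rewrite mulSn.
  rewrite -[LHS]addrA -[RHS]addrA; congr (_ + _).
  by rewrite addrA subrK (addrC c) addrACA subrr addr0.
apply/eqP; rewrite -subr_eq0; apply/eqP/rnorm0_eq0/eqP.
rewrite eq_le rnorm_ge0 andbT; apply/ler_addgt0Pr => d d0; rewrite add0r.
have d30 : 0 < d / 4 by lra.
have vz' : (fun m => x' + series v m) @ \oo --> x' + z by apply: cvgD => //; exact: cvg_cst.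
have /rnorm_cvgnP/(_ _ d30)[N1 N1P] := vz'.
have /rnorm_cvgnP/(_ _ d30)[N2 N2P] := cvg_iterl (n := n) vz'.
have [N3 N3P] := unconditionally_cauchy_term (T_cauchy x0) d30.
have [N4 N4P] := unconditionally_cauchy_term (S_cauchy x0) d30.
pose m := maxn (maxn N1 N2) (maxn N3 N4).
have m1 : (N1 <= m)%N by rewrite !leq_max leqnn.
have m2 : (N2 <= m)%N by rewrite !leq_max leqnn orbT.
have m3 : (N3 <= m)%N by rewrite !leq_max leqnn !orbT.
have m4 : (N4 <= m)%N by rewrite !leq_max leqnn !orbT.
have {}N2P := ltW (N2P m m2); have {}N1P := ltW (N1P m m1).
rewrite (le_trans (rnorm_subD (iter n T (x' + series v m)) _ _))//.
have h3 : rnorm (iter (f m) T x') <= d / 4 by apply: N3P; rewrite (leq_trans m3)//; apply: fge.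
have h4 : rnorm (iter (m * n) S x') <= d / 4.
  by apply: N4P; rewrite (leq_trans m4)// leq_pmulr.
have : rnorm (iter n T (x' + series v m) - (x' + z)) <= d / 4 + (d / 4 + d / 4).
  rewrite (le_trans (rnorm_subD (x' + series v m) _ _))// addrC lerD//.
    by rewrite rnormB.
  by rewrite shift addrAC subrr add0r (le_trans (rnormD _ _))// rnormN lerD.
move: N2P; lra.
Qed.

Lemma criterion_frequently_hypercyclic (z : nat -> X) : (forall i, X0 (z i)) ->
  (forall x (e : R), 0 < e -> exists i, rnorm (x - z i) < e) ->
  frequently_hypercyclic T.
Proof.
(* Each [z i] is repeated under infinitely many labels [k], so the tolerance attached to [k] can be
   made small without changing the target. *)
move=> zX0 z_dense; pose y k := z (logn 2 k.+1).
have yX0 k : X0 (y k) by exact: zX0.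
have w0 k : 0 < w k by rewrite exprn_gt0.
have /choice[N0 N0P] : forall kl : nat * nat, exists N, forall s, uniq s ->
    all (leq N) s -> rnorm (\sum_(i <- s) iter i T (y kl.1)) <= w kl.2 * w kl.2 /\
      rnorm (\sum_(i <- s) iter i S (y kl.1)) <= w kl.2 * w kl.2.
  move=> [k l] /=; have [N TN] := T_cauchy (yX0 k) (mulr_gt0 (w0 l) (w0 l)).
  have [N' SN] := S_cauchy (yX0 k) (mulr_gt0 (w0 l) (w0 l)).
  exists (maxn N N') => s us /allP Ns; split.
    by apply: TN => //; apply/allP => i /Ns/=; rewrite geq_max => /andP[].
  by apply: SN => //; apply/allP => i /Ns/=; rewrite geq_max => /andP[].
(* The worst threshold over all labels [k <= l] at tolerance $4^{-l}$. *)
pose N l := \max_(k < l.+1) N0 (k : nat, l).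
have NP k l s : (k <= l)%N -> uniq s -> all (leq (N l)) s ->
    rnorm (\sum_(i <- s) iter i T (y k)) <= w l * w l /\
    rnorm (\sum_(i <- s) iter i S (y k)) <= w l * w l.
  move=> kl us /allP Ns; apply: (N0P (k, l)) => //; apply/allP => i /Ns /=.
  apply: leq_trans; rewrite -ltnS in kl.
  exact: (leq_bigmax (F := fun k : 'I_l.+1 => N0 (k : nat, l)) (Ordinal kl)).
have TN k l s kl us Ns := (@NP k l s kl us Ns).1.
have SN k l s kl us Ns := (@NP k l s kl us Ns).2.
have [lab [p [p_sep p_ge lab_freq]]] := separated_labelling N.
have p_lt m n : (m < n)%N -> (p m < p n)%N.
  by move=> /p_sep[+ _]; apply: leq_ltn_trans; exact: leq_addl.
have p_inj : injective p.
  by move=> m n; case: (ltngtP m n) => // /p_lt + pmn; rewrite pmn ltnn.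
pose u n := iter (p n) S (y (lab n)).
(* Blocks of the series past index [N j] are labelled sums with displacements [p n], hence at most
   $2\cdot 2^{-j}$. *)
have [x ux] : exists x : X, series u @ \oo --> x.
  apply: cX => e e0.
  have [j je] : exists j, 2 * w j <= e.
    have e20 : 0 < e / 2 by lra.
    have /cvgrPdist_lt/(_ _ e20)[j _ jP] : w @ \oo --> (0 : R).
      by apply: cvg_expr; rewrite ger0_norm ?invr_ge0//; lra.
    exists j; have := jP j (leqnn j); rewrite /= sub0r normrN ger0_norm ?(ltW (w0 _))//.
    lra.
  exists (N j) => m n Nm mn; rewrite seriesB// (le_trans _ je)//.
  apply: (rnorm_labelled_sum SN) => [|m' n' _ _ /p_inj//|i].
    exact: iota_uniq.
  rewrite mem_index_iota => /andP[mi _]; have [pi Ni] := p_ge i; split => //.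
  by rewrite (leq_trans Nm)// (leq_trans mi).
exists x => U oU [x0 Ux0].
have [e e0 eU] := open_rnorm oU Ux0.
have e20 : 0 < e / 2 by lra.
have [i ie] := z_dense x0 _ e20.
have [k yk we] : exists2 k, y k = z i & 4 * w k <= e / 2.
  have e80 : 0 < e / 8 by lra.
  have /cvgrPdist_lt/(_ _ e80)[j _ jP] : w @ \oo --> (0 : R).
    by apply: cvg_expr; rewrite ger0_norm ?invr_ge0//; lra.
  pose k := (2 ^ i * j.*2.+1).-1.
  have kS : k.+1 = (2 ^ i * j.*2.+1)%N by rewrite prednK// muln_gt0 expn_gt0.
  exists k; first by rewrite /y kS logn2_odd_mul.
  have jk : (j <= k)%N.
    rewrite -ltnS kS (@leq_trans j.*2.+1)// ?leq_pmull ?expn_gt0//.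
    by rewrite ltnS -addnn leq_addr.
  have := jP k jk; rewrite /= sub0r normrN ger0_norm ?(ltW (w0 _))//; lra.
have [K [f [f_inj fP]]] := lab_freq k.
apply: (@lower_density_gt0 _ _ (p \o f) K) => [m n /p_inj/f_inj//|t].
have [labk pK] := fP t; split => //=; apply: eU; set m := f t in labk pK *.
(* $T^{p_m}$ turns the earlier terms into $T^{p_m-p_n}y$, the term of index $m$ into $y_k$, and the
   later ones into $S^{p_n-p_m}y$. The separation of positions makes each of the two outer groups a
   labelled sum with [j := k], costing $2\cdot 2^{-k}$. *)
have : rnorm (iter (p m) T x - y k) <= 4 * w k.
  apply: (cvg_rnorm_le (cvg_iterl (n := p m) ux) (N := m.+1)) => n mn.
  rewrite seriesEnat/= iterl_sum (big_cat_nat (n := m))//=; last exact: ltnW.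
  rewrite (big_ltn mn) /u labk iter_right_inverse_ge// subnn.
  rewrite addrCA addrAC subrr add0r (le_trans (rnormD _ _))//.
  rewrite (_ : 4 * w k = 2 * w k + 2 * w k); last by lra.
  rewrite lerD//.
    rewrite (eq_big_nat _ _ (F2 := fun n => iter (p m - p n) T (y (lab n)))).
      apply: (rnorm_labelled_sum TN) => [||i'].
      - exact: iota_uniq.
      - move=> a b; rewrite !mem_index_iota => /p_lt/ltnW pa /p_lt/ltnW pb pab.
        by apply: p_inj; rewrite -(subKn pa) pab subKn.
      - rewrite mem_index_iota => /p_sep[]; rewrite labk => h1 h2.
        by split; move: h1 h2; lia.
    by move=> a /p_lt/ltnW pa; rewrite iter_right_inverse_le.
  rewrite (eq_big_nat _ _ (F2 := fun n => iter (p n - p m) S (y (lab n)))).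
    apply: (rnorm_labelled_sum SN) => [||i'].
    - exact: iota_uniq.
    - move=> a b; rewrite !mem_index_iota => /andP[/p_lt/ltnW pa _] /andP[/p_lt/ltnW pb _] pab.
      by apply: p_inj; rewrite -(subnK pa) pab subnK.
    - rewrite mem_index_iota => /andP[/p_sep[]]; rewrite labk => h1 h2 _.
      by split; move: h1 h2; lia.
  by move=> a /andP[/p_lt/ltnW pa _]; rewrite iter_right_inverse_ge.
rewrite yk => h1; rewrite (le_lt_trans (rnorm_subD (z i) _ _))//.
by rewrite [X in _ + X]rnormB [e]splitr ltr_leD// (le_trans h1).
Qed.

End FrequentHypercyclicityCriterion.

(** An open set missed by the orbit has an empty set of visits, of lower density 0. *)
Lemma frequently_hypercyclic_hypercyclic (R : realType) (X : normedModType R[i])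
    (T : X -> X) : frequently_hypercyclic T -> hypercyclic T.
Proof.
move=> [x fx]; exists x => U [y Uy] oU.
have := fx _ oU (ex_intro _ y Uy); apply: contraPP => UN.
have -> : [set n | U (iter n T x)] = set0.
  by rewrite -subset0 => n /= Un; apply: UN; exists (iter n T x); split => //; exists n.
rewrite /lower_density (_ : (fun n => _) = cst 0%E).
  rewrite (cvg_limn_einf_sup (cvg_cst _)).1 ltxx//.
apply/funext => n /=; rewrite eq_card0 ?mul0r// => i; rewrite !inE.
by apply/negbTE/negP; rewrite inE.
Qed.

(** * The Hilbert module of square-summable sequences *)

Lemma complete_sequentially (R : realType) (V : completeNormedModType R[i]) :
  sequentially_complete V.
Proof.
move=> u cu; apply/cvg_ex; apply: cauchy_cvg; apply/rnorm_cauchyP => e e0.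
have e20 : 0 < e / 2 by lra.
have [N Ne] := cu _ e20; exists (u N); exists N => // n /= Nn.
by rewrite rnormB (le_lt_trans (Ne _ _ (leqnn N) Nn))//; lra.
Qed.

Lemma ler_sum_uniq_subseq (R : realDomainType) (I : eqType) (r s : seq I)
    (f : I -> R) :
  uniq r -> uniq s -> {subset r <= s} -> (forall i, 0 <= f i) ->
  \sum_(i <- r) f i <= \sum_(i <- s) f i.
Proof.
move=> ur us rs f0; rewrite [leRHS](bigID (mem r))/= -[leLHS]addr0.
apply: lerD; last exact: sumr_ge0.
rewrite -[leRHS]big_filter le_eqVlt; apply/orP; left; apply/eqP; apply: perm_big.
apply: uniq_perm; rewrite ?filter_uniq// => i; rewrite mem_filter.
by apply/idP/andP => [ir|[]//]; split=> //; exact: rs.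
Qed.

(** A quotient $q$ is attained by at most $n$ indices, and indices from $Nn$ on have quotient at
    least $N$. *)
Lemma ler_sum_divn (R : realDomainType) (a : nat -> R) (n N : nat) (s : seq nat) :
  (0 < n)%N -> (forall q, 0 <= a q) -> uniq s -> all (leq (N * n)) s ->
  exists B, \sum_(d <- s) a (d %/ n)%N <= (\sum_(N <= q < B) a q) *+ n.
Proof.
move=> n0 a0 us /allP Ns; exists (maxn N (\max_(d <- s) d).+1); set B := maxn _ _.
(* Cutting off below [N] allows [s] to be enlarged to the whole of [[0, B * n[], which splits into
   blocks of length [n] with constant quotient. *)
pose b q := if (N <= q)%N then a q else 0.
have b0 q : 0 <= b q by rewrite /b; case: ifP.
have -> : \sum_(d <- s) a (d %/ n)%N = \sum_(d <- s) b (d %/ n)%N.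
  by apply: eq_big_seq => d /Ns/= Nd; rewrite /b leq_divRL// Nd.
rewrite (le_trans (@ler_sum_uniq_subseq _ _ s (index_iota 0 (B * n))
  (fun d => b (d %/ n)%N) us (iota_uniq _ _) _ _))//.
  move=> d ds; rewrite mem_index_iota /= (@leq_trans B)// ?leq_pmulr//.
  by rewrite leq_max ltnS; apply/orP; right; rewrite (bigD1_seq d)//= leq_maxl.
rewrite big_nat_mul -sumrMnl.
have -> : \sum_(N <= q < B) a q *+ n = \sum_(N <= q < B) b q *+ n.
  by apply: eq_big_nat => q /andP[Nq _]; rewrite /b Nq.
rewrite (big_cat_nat (n := N))//= ?leq_maxl// big_nat big1 => [|q /andP[_ qN]].
  rewrite add0r le_eqVlt; apply/orP; left; apply/eqP; apply: eq_bigr => q _.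
  rewrite (eq_big_nat _ _ (F2 := fun=> b q)) => [|d /andP[qd dq]].
    by rewrite sumr_const_nat mulSn addnK.
  congr b; apply/eqP; rewrite eqn_leq leq_divRL// qd andbT.
  by rewrite -ltnS ltn_divLR.
rewrite (eq_big_nat _ _ (F2 := fun=> 0)) => [|d /andP[_ dq]].
  by rewrite big1.
by rewrite /b leqNgt ltn_divLR// (leq_trans dq)// leq_mul2r qN orbT.
Qed.

Section Ell2Space.
Variables (R : realType) (H : hilbertType R).
Local Notation BH := (bounded_op H).
Local Notation E := (ell2 H).
Implicit Types (x y : E).

Lemma ell2DE x y j : (x + y) j = x j + y j. Proof. by []. Qed.
Lemma ell2BE x y j : (x - y) j = x j - y j. Proof. by []. Qed.
Lemma ell2_sumE (I : Type) (r : seq I) (Q : pred I) (F : I -> E) j :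
  (\sum_(i <- r | Q i) F i) j = \sum_(i <- r | Q i) F i j.
Proof. by elim/big_rec2: _ => // i a b _ <-. Qed.

Lemma qsum_rnorm x F h : qsum x F h <= rnorm x ^+ 2 * rnorm h ^+ 2.
Proof. by have /ell2_normP := lexx (ell2_norm x); apply; exact: ell2_norm_ge0. Qed.

Lemma rnorm_ell2_le x (c : R) : 0 <= c ->
  (forall F h, qsum x F h <= c ^+ 2 * rnorm h ^+ 2) -> rnorm x <= c.
Proof. by move=> c0 xc; apply/ell2_normP. Qed.

Lemma rnorm_ell2_coord x j : rnorm (x j) <= rnorm x.
Proof.
apply: rnorm_bop_le => [|h]; first exact: rnorm_ge0.
rewrite -(@ler_pXn2r _ 2)// ?nnegrE ?mulr_ge0 ?rnorm_ge0// exprMn.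
by have := qsum_rnorm x [fset j]%fset h; rewrite /qsum big_seq_fset1.
Qed.

(** With [F] and [h] fixed this is continuity of a finite sum; it lets a bound on $u_n-u_m$, uniform
    in [F] and [h], pass to the limit in $m$. *)
Lemma qsum_le_lim (v : nat -> int -> BH) (l : int -> BH) F h (c : R) N :
  (forall j, (fun n => v n j) @ \oo --> l j) ->
  (forall n, (N <= n)%N -> qsum (v n) F h <= c) -> qsum l F h <= c.
Proof.
move=> vl vc.
have cv : (fun n => qsum (v n) F h) @ \oo --> (qsum l F h : R).
  rewrite /qsum; apply: cvg_big => [|j _]; first exact: add_continuous.
  have cj : (fun n => rnorm (v n j h)) @ \oo --> (rnorm (l j h) : R).
    apply/cvgrPdist_lt => e e0.
    have h0 : 0 < rnorm h + 1 by rewrite ltr_wpDl ?rnorm_ge0.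
    have /rnorm_cvgnP/(_ _ (divr_gt0 e0 h0))[n0 n0P] := vl j.
    exists n0 => // n /= /n0P; rewrite ltr_pdivlMr// => le1.
    have le2 : rnorm (l j h - v n j h) < e.
      rewrite -bopBE (le_lt_trans (rnorm_bopP _ _))// (le_lt_trans _ le1)//.
      by rewrite ler_wpM2l ?rnorm_ge0// lerDl.
    have := rnormD (l j h - v n j h) (v n j h).
    have := rnormD (v n j h - l j h) (l j h); rewrite !subrK rnormB => le3 le4.
    by rewrite ltr_norml; move: le2 le3 le4; move: (rnorm _) (rnorm _) => a b; lra.
  by rewrite expr2; apply: cvgM.
apply/ler_addgt0Pr => e e0.
have /cvgrPdist_lt/(_ _ e0)[n0 _ n0P] := cv.
have := n0P (maxn n0 N) (leq_maxl _ _); rewrite /= ltr_norml => /andP[_ le1].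
have := vc (maxn n0 N) (leq_maxr _ _); move: le1.
by move: (qsum _ _ _) (qsum _ _ _) => a b; lra.
Qed.

(** The limit is taken coordinatewise, where compactness persists. The uniform Cauchy bound on
    quadratic forms then yields both its square-summability and convergence in norm. *)
Lemma ell2_complete : sequentially_complete E.
Proof.
move=> u cu.
have cuj j : exists l : BH, (fun n => u n j) @ \oo --> l.
  apply: (@complete_sequentially _ BH) => e /cu[N Ne]; exists N => m n Nm mn.
  by rewrite -ell2BE (le_trans (rnorm_ell2_coord _ _))// Ne.
have /choice[l ul] := cuj.
have lc j : compact_op (l j).
  apply: (@compact_op_lim _ _ _ \oo _ (fun n => u n j)) (ul j) => n.
  exact: ell2_compact.
have ule (e : R) : 0 < e -> exists N, forall n, (N <= n)%N -> forall F h,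
    qsum (fun j => u n j - l j) F h <= e ^+ 2 * rnorm h ^+ 2.
  move=> e0; have [N Ne] := cu _ e0; exists N => n Nn F h.
  apply: (@qsum_le_lim (fun m j => u n j - u m j) _ _ _ _ n) => [j|m nm].
    by apply: cvgB; [exact: cvg_cst|exact: ul].
  rewrite (le_trans (qsum_rnorm (u n - u m) F h))// ler_wpM2r ?sqr_ge0//.
  by rewrite ler_pXn2r ?nnegrE ?rnorm_ge0 ?(ltW e0)// rnormB Ne.
have lt : qtail l.
  move=> e e0; have e40 : 0 < e / 4 by lra.
  (* [ule] bounds by a square, hence the root; [qsumD] with equal weights doubles two quarters of
     [e]. *)
  have s0 : 0 < Num.sqrt (e / 4) by rewrite sqrtr_gt0.
  have [N /(_ N (leqnn N)) NP] := ule _ s0.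
  have [F FP] := ell2_tail (u N) e40; exists F => G h.
  have -> : qsum l (G `\` F)%fset h =
      qsum (fun j => u N j + (l j - u N j)) (G `\` F)%fset h.
    by apply: eq_bigr => j _; rewrite addrC subrK.
  rewrite (le_trans (@qsumD _ _ _ _ _ _ 1 1 ltr01 ltr01))//.
  have := FP G h; have := NP (G `\` F)%fset h.
  have -> : qsum (fun j => u N j - l j) (G `\` F)%fset h =
      qsum (fun j => l j - u N j) (G `\` F)%fset h.
    by apply: eq_bigr => j _; rewrite bopBE rnormB.
  rewrite sqr_sqrtr ?(ltW e40)//.
  by move: (qsum _ _ _) (qsum _ _ _) (rnorm h ^+ 2) => a b q; lra.
exists (mk_ell2 lc lt); apply/rnorm_cvgnP => e e0.
have e20 : 0 < e / 2 by lra.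
have [N NP] := ule _ e20; exists N => n Nn.
rewrite rnormB (@le_lt_trans _ _ (e / 2))//; last by lra.
by apply: rnorm_ell2_le => [|F h]; [exact: ltW|exact: NP].
Qed.

Fact single_tail (j : int) (f : BH) : qtail (fun i => if i == j then f else 0).
Proof.
move=> e e0; exists [fset j]%fset => G h.
rewrite /qsum big_seq big1 => [|i]; first by rewrite mulr_ge0 ?sqr_ge0 ?ltW.
by rewrite !inE => /andP[/negPf-> _]; rewrite rnorm0 expr0n.
Qed.

Fact single_compact (j : int) (f : BH) : compact_op f ->
  forall i, compact_op (if i == j then f else 0).
Proof. by move=> fc i; case: ifP => // _; exact: compact_op0. Qed.

Definition single (j : int) (f : BH) (fc : compact_op f) : E :=
  mk_ell2 (single_compact j fc) (@single_tail j f).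

Lemma singleE j f (fc : compact_op f) i : single j fc i = if i == j then f else 0.
Proof. by []. Qed.

(** The analogue of [qtail] for families indexed by [nat], before they are placed at positions in
    [int]. *)
Definition square_summable (y : nat -> BH) := forall e : R, 0 < e -> exists N,
  forall r, uniq r -> all (leq N) r -> forall h,
  \sum_(n <- r) rnorm (y n h) ^+ 2 <= e * rnorm h ^+ 2.

(** Injectivity of [pos] keeps the summands in distinct coordinates, so squares add up instead of
    norms. *)
Lemma rnorm_sum_single (pos : nat -> int) (y : nat -> BH)
    (yc : forall n, compact_op (y n)) (r : seq nat) (c : R) :
  injective pos -> uniq r -> 0 <= c ->
  (forall h, \sum_(n <- r) rnorm (y n h) ^+ 2 <= c ^+ 2 * rnorm h ^+ 2) ->
  rnorm (\sum_(n <- r) single (pos n) (yc n)) <= c.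
Proof.
move=> pos_inj ur c0 yr; apply: rnorm_ell2_le => // F h; apply: le_trans (yr h).
elim: r ur {yr} => [|n r IH] /= => [_|/andP[nr ur]].
  by rewrite !big_nil /qsum big1// => j _; rewrite rnorm0 expr0n.
rewrite !big_cons.
set x := \sum_(i <- r) _ in IH *.
have x0 : x (pos n) = 0.
  rewrite ell2_sumE big_seq big1// => i ir; rewrite singleE.
  by case: eqP => // /pos_inj ni; rewrite ni ir in nr.
have -> : qsum (single (pos n) (yc n) + x) F h =
    \sum_(i <- F) (if i == pos n then rnorm (y n h) ^+ 2 else 0) + qsum x F h.
  rewrite /qsum -big_split/=; apply: eq_bigr => i _.
  have h0 : (0 : BH) h = 0 by [].
  case: eqP => [->|_]; last by rewrite h0 !add0r.
  by rewrite x0 h0 addr0 rnorm0 expr0n addr0.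
apply: lerD; last exact: IH.
rewrite -big_mkcond/=.
have [nF|nF] := boolP (pos n \in F).
  by rewrite -big_filter filter_pred1_uniq ?fset_uniq// big_seq1.
rewrite big_seq_cond big_pred0 ?sqr_ge0// => i.
by apply/andP => -[iF /eqP ni]; rewrite -ni iF in nF.
Qed.

Lemma rnorm_single j f (fc : compact_op f) : rnorm (single j fc) <= rnorm f.
Proof.
apply: rnorm_ell2_le => [|F h]; first exact: rnorm_ge0.
rewrite /qsum (eq_bigr (fun i => if i == j then rnorm (f h) ^+ 2 else 0)).
  rewrite -big_mkcond/=.
  have fh : rnorm (f h) ^+ 2 <= rnorm f ^+ 2 * rnorm h ^+ 2.
    by rewrite -exprMn ler_pXn2r ?nnegrE ?mulr_ge0 ?rnorm_ge0// rnorm_bopP.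
  have [jF|jF] := boolP (j \in F).
    by rewrite -big_filter filter_pred1_uniq ?fset_uniq// big_seq1.
  rewrite big_seq_cond big_pred0; first exact: le_trans (sqr_ge0 _) fh.
  by move=> i; apply/andP => -[iF /eqP ij]; rewrite -ij iF in jF.
by move=> i _; rewrite singleE; case: eqP => // _; rewrite rnorm0 expr0n.
Qed.

Lemma unconditionally_cauchy_single (pos : nat -> int) (y : nat -> BH)
    (yc : forall n, compact_op (y n)) : injective pos -> square_summable y ->
  unconditionally_cauchy (fun n => single (pos n) (yc n)).
Proof.
move=> pos_inj sy e e0; have [N NP] := sy _ (exprn_gt0 2 e0); exists N => r ur Nr.
by apply: rnorm_sum_single => // [|h]; [exact: ltW|exact: NP].
Qed.

Lemma reip_adj_mul (f : BH) h : reip ((adj f * f) h) h = rnorm (f h) ^+ 2.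
Proof. by rewrite reipC /reip bopME -adjP -/(reip _ _) reip_norm. Qed.

(** By positivity a finite set of late indices is dominated by an interval, and the sum over an
    interval is a difference of two partial sums. *)
Lemma cvg_square_summable (y : nat -> BH) :
  cvg_in_B0 (\sum_(1 <= l < N.+1) adj (y l) * y l @[N --> \oo]) ->
  square_summable y.
Proof.
move=> [S _ /rnorm_cvgnP yS] e e0; have e20 : 0 < e / 2 by lra.
have [N NP] := yS _ e20; exists N.+1 => r ur /allP Nr h.
pose B := maxn N (\max_(l <- r) l).
have NB : (N <= B)%N by exact: leq_maxl.
apply: (@le_trans _ _ (\sum_(N.+1 <= l < B.+1) rnorm (y l h) ^+ 2)).
  apply: ler_sum_uniq_subseq => // [||l]; [exact: iota_uniq| |exact: sqr_ge0].
  move=> l lr; rewrite mem_index_iota Nr//= ltnS leq_max; apply/orP; right.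
  by rewrite (bigD1_seq l)//= leq_maxl.
have -> : \sum_(N.+1 <= l < B.+1) rnorm (y l h) ^+ 2 =
    reip ((\sum_(1 <= l < B.+1) adj (y l) * y l -
           \sum_(1 <= l < N.+1) adj (y l) * y l) h) h.
  rewrite (big_cat_nat (n := N.+1) (m := 1%N) (p := B.+1))//=.
  rewrite addrAC subrr add0r bop_sumE reip_suml.
  by apply: eq_bigr => l _; rewrite reip_adj_mul.
rewrite (le_trans (reip_le _ _))// expr2 mulrA ler_wpM2r ?rnorm_ge0//.
rewrite (le_trans (rnorm_bopP _ _))// ler_wpM2r ?rnorm_ge0//.
rewrite (le_trans (rnorm_subD S _ _))// [leRHS]splitr lerD//.
  by rewrite rnormB; apply/ltW/NP.
by apply/ltW/NP.
Qed.

Lemma injective_eventually_notin (pos : nat -> int) (F : {fset int}) :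
  injective pos -> exists N, forall l, (N <= l)%N -> pos l \notin F.
Proof.
move=> pos_inj.
suff : forall s : seq int, exists N, forall l, (N <= l)%N -> pos l \notin s.
  by move=> /(_ F).
elim=> [|i s [N NP]]; first by exists 0%N.
have [[k ki]|ki] := pselect (exists k, pos k = i).
  exists (maxn N k.+1) => l; rewrite geq_max => /andP[Nl kl].
  rewrite inE negb_or NP// andbT -ki; apply/eqP => /pos_inj kl'.
  by rewrite kl' ltnn in kl.
exists N => l Nl; rewrite inE negb_or NP// andbT.
by apply/eqP => li; apply: ki; exists l.
Qed.

(** [qtail] ranges over all finite sets, so it controls the sums along any injective sequence of
    positions. *)
Lemma ell2_subseries_cvg x (pos : nat -> int) : injective pos ->
  cvg_in_B0 (\sum_(1 <= l < N.+1) adj (x (pos l)) * x (pos l) @[N --> \oo]).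
Proof.
move=> pos_inj; pose S N : BH := \sum_(1 <= l < N.+1) adj (x (pos l)) * x (pos l).
have [l Sl] : exists l : BH, S @ \oo --> l.
  apply: (@complete_sequentially _ BH) => e e0.
  have [F FP] := ell2_tail x e0; have [N NP] := injective_eventually_notin F pos_inj.
  exists N => m n Nm mn.
  rewrite /S (big_cat_nat (n := m.+1) (m := 1%N) (p := n.+1))//=.
  rewrite addrAC subrr add0r.
  pose G := [fset pos l | l in index_iota m.+1 n.+1]%fset.
  have -> : \sum_(m.+1 <= l < n.+1) adj (x (pos l)) * x (pos l) = gram_sum x G.
    rewrite gram_sumE big_imfset/=; last by move=> i j _ _ /pos_inj.
    by rewrite undup_id ?iota_uniq.
  apply: gram_le => [|h]; first exact: ltW.
  have := FP G h; congr (qsum _ _ _ <= _); apply/fsetP => i; rewrite in_fsetD.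
  case: (boolP (i \in G)) => [|_]; last by rewrite andbF.
  move=> /imfsetP[l /=]; rewrite mem_index_iota => /andP[ml _] ->.
  by rewrite NP// (leq_trans Nm)// ltnW.
exists l => //; apply: (@compact_op_lim _ _ _ \oo _ S) Sl => N.
by apply: compact_op_sum => k _; apply: compact_op_mull; exact: ell2_compact.
Qed.

End Ell2Space.

(** * Finite-rank approximation *)

Section SymmetricInterval.

(** Enumerates both the positions in $[J]$ and the basis indices of $L_m$. *)
Definition zseq (J : nat) : seq int := [seq k%:Z - J%:Z | k <- iota 0 (J + J).+1].

Lemma mem_zseq J i : (i \in zseq J) = (- J%:Z <= i <= J%:Z).
Proof.
apply/mapP/idP => [[k + ->]|iJ]; first by rewrite mem_iota; lia.
by exists (absz (i + J%:Z)); [rewrite mem_iota; lia|lia].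
Qed.

Lemma zseq_uniq J : uniq (zseq J).
Proof. by rewrite map_inj_uniq ?iota_uniq// => i j; lia. Qed.

Lemma fset_sub_zseq (F : {fset int}) : exists J, {subset F <= zseq J}.
Proof.
exists (\max_(i <- F) absz i) => i iF; rewrite mem_zseq.
have : (absz i <= \max_(i <- F) absz i)%N.
  by rewrite (bigD1_seq i) ?fset_uniq//= leq_maxl.
lia.
Qed.

Lemma zseq_sub J J' : (J <= J')%N -> {subset zseq J <= zseq J'}.
Proof. by move=> JJ' i; rewrite !mem_zseq; lia. Qed.

End SymmetricInterval.

Lemma seq_eventually (I : eqType) (s : seq I) (Q : I -> nat -> Prop) :
  (forall i, exists N, forall n, (N <= n)%N -> Q i n) ->
  exists N, forall n, (N <= n)%N -> forall i, i \in s -> Q i n.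
Proof.
move=> QN; elim: s => [|i s [N NP]]; first by exists 0%N.
have [N' N'P] := QN i; exists (maxn N N') => n; rewrite geq_max => /andP[Nn N'n] j.
by rewrite inE => /orP[/eqP->|]; [exact: N'P|exact: NP].
Qed.

Section RankOne.
Variables (R : realType) (H : hilbertType R).
Local Notation BH := (bounded_op H).
Implicit Types (u v h : H).

(** [reip_le] only bounds the real part; multiplying [u] by the conjugate of [ip u v] makes the
    inner product real and nonnegative. *)
Lemma ip_le u v : complex.Re `|ip u v| <= rnorm u * rnorm v.
Proof.
set z := ip u v; set t := complex.Re `|z|.
have tE : `|z| = t%:C by rewrite /t RRe_real ?normr_real.
have t0 : 0 <= t by have := normr_ge0 z; rewrite tE lecR.
have [->|tN0] := eqVneq t 0; first by rewrite mulr_ge0 ?rnorm_ge0.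
have t1 : 0 < t by rewrite lt_neqAle eq_sym tN0.
rewrite -(ler_pM2l t1) mulrA.
have -> : t * t = reip (z^* *: u) v.
  rewrite /reip ipZl -/z [X in complex.Re X]mulrC -normCK tE -rmorphXn.
  by rewrite expr2.
rewrite (le_trans (reip_le _ _))// ler_wpM2r ?rnorm_ge0// rnormZ norm_conjC.
by rewrite -/t.
Qed.

Fact rank1_linear u v : linear (fun h => ip h v *: u).
Proof. by move=> a h k; rewrite ipDl ipZl scalerDl scalerA. Qed.

Fact rank1_bounded u v :
  exists M : R, forall h, rnorm (ip h v *: u) <= M * rnorm h.
Proof.
exists (rnorm v * rnorm u) => h; rewrite rnormZ mulrAC ler_wpM2r ?rnorm_ge0//.
by rewrite mulrC ip_le.
Qed.

Definition rank1 u v : BH := BoundedOp (rank1_linear u v) (rank1_bounded u v).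

Lemma rank1E u v h : rank1 u v h = ip h v *: u. Proof. by []. Qed.

Lemma rnorm_rank1 u v : rnorm (rank1 u v) <= rnorm v * rnorm u.
Proof.
apply: rnorm_bop_le => [|h]; first by rewrite mulr_ge0 ?rnorm_ge0.
by rewrite rank1E rnormZ mulrAC ler_wpM2r ?rnorm_ge0// mulrC ip_le.
Qed.

Lemma rank1B u v v' : rank1 u v - rank1 u v' = rank1 u (v - v').
Proof. by apply/bopP => h; rewrite bopBE !rank1E -scalerBl -ipBr. Qed.

Lemma normc_le (a b : R) : complex.Re `|a +i* b| <= `|a| + `|b|.
Proof.
have -> : a +i* b = a%:C + 'i * b%:C by rewrite [LHS]complexE.
apply: (@le_trans _ _ (complex.Re (`|a%:C| + `|'i * b%:C|))).
  have := ler_normD a%:C ('i * b%:C); rewrite lecE => /andP[_].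
  by [].
by rewrite normrM normCi mul1r !normc_def /= !expr0n /= !addr0 !sqrtr_sqr.
Qed.

Lemma real_grid (M d : R) : 0 < d ->
  exists s : seq R, forall r, `|r| <= M -> exists2 t, t \in s & `|r - t| < d.
Proof.
move=> d0; have [N MN] : exists N : nat, M / d < N%:R.
  by exists (Num.truncn (M / d)).+1; exact: truncnS_gt.
exists [seq k%:~R * d | k <- zseq N.+1] => r rM.
exists ((Num.floor (r / d))%:~R * d).
  apply/mapP; exists (Num.floor (r / d)) => //; rewrite mem_zseq.
  have rd : `|r / d| < N%:R.
    by rewrite normrM normfV (gtr0_norm d0) (le_lt_trans _ MN)// ler_pM2r ?invr_gt0.
  move: rd; rewrite ltr_norml => /andP[r1 r2].
  have := floor_le (r / d); have := floorD1_gt (r / d).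
  move=> f1 f2; rewrite -!(ler_int R) rmorphN/=.
  have -> : N.+1%:Z%:~R = N%:R + 1 :> R by rewrite -pmulrn -natr1.
  by move: f1; rewrite intrD; lra.
have := floor_le (r / d); have := floorD1_gt (r / d).
rewrite intrD ltr_pdivrMr// ler_pdivlMr// mulrDl mul1r => f1 f2.
by rewrite ger0_norm; lra.
Qed.

(** The unit ball is sent to multiples of [u] with bounded coefficient, and a finite grid of
    coefficients gives the net. The mesh is halved because real and imaginary parts both
    contribute. *)
Lemma compact_rank1 u v : compact_op (rank1 u v).
Proof.
apply/compact_opP => e e0.
have u0 : 0 < rnorm u + 1 by rewrite ltr_wpDl ?rnorm_ge0.
have d0 : 0 < e / (rnorm u + 1) / 2 by rewrite !divr_gt0.
have [s sP] := real_grid (rnorm v) d0.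
exists [seq (a +i* b) *: u | a <- s, b <- s] => _ [h h1 <-]; rewrite rank1E.
have ipv : complex.Re `|ip h v| <= rnorm v.
  by rewrite (le_trans (ip_le _ _))// -[leRHS]mul1r ler_wpM2r ?rnorm_ge0.
have [a [b [ipE aM bM]]] : exists a b : R,
    [/\ ip h v = a +i* b, `|a| <= rnorm v & `|b| <= rnorm v].
  case: (ip h v) ipv => a b; rewrite normc_def /= => ab; exists a, b; split => //.
    by rewrite (le_trans _ ab)// -sqrtr_sqr ler_sqrt ?lerDl ?addr_ge0 ?sqr_ge0.
  by rewrite (le_trans _ ab)// -sqrtr_sqr ler_sqrt ?lerDr ?addr_ge0 ?sqr_ge0.
have [a' a's aa'] := sP _ aM; have [b' b's bb'] := sP _ bM.
exists ((a' +i* b') *: u); first by apply/allpairsP; exists (a', b').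
rewrite ipE -scalerBl rnormZ.
have -> : (a' +i* b') - (a +i* b) = (a' - a) +i* (b' - b) by [].
have le1 := normc_le (a' - a) (b' - b); rewrite distrC (distrC b') in le1.
have le2 : complex.Re `|(a' - a) +i* (b' - b)| < e / (rnorm u + 1) by lra.
rewrite (@le_lt_trans _ _ (complex.Re `|(a' - a) +i* (b' - b)| * (rnorm u + 1)))//.
  rewrite ler_wpM2l ?lerDl//; exact: (rnorm_ge0 ((a' - a) +i* (b' - b) : R[i]^o)).
by rewrite -ltr_pdivlMr.
Qed.

End RankOne.

Section BasisProjections.
Variables (R : realType) (H : hilbertType R) (e : int -> H) (P : nat -> bounded_op H).
Hypothesis e_basis : orthonormal_basis e.
Hypothesis P_proj : forall m, orthogonal_projection (basis_section e m) (P m).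
Local Notation BH := (bounded_op H).

Lemma linear_span_gen (A : set H) a : A a -> linear_span A a.
Proof. by move=> Aa; exists 1%N, (fun=> 1), (fun=> a); rewrite big_ord1 scale1r. Qed.

Lemma basis_section_expand m v : basis_section e m v ->
  v = \sum_(i <- zseq m) ip v (e i) *: e i.
Proof.
move=> [n [c [a [ea ->]]]].
have aE i : a i = \sum_(k <- zseq m) ip (a i) (e k) *: e k.
  have [k km <-] := ea i; rewrite (bigD1_seq k) ?zseq_uniq//=; last by rewrite mem_zseq.
  rewrite (e_basis.1 k k) eqxx scale1r big1 ?addr0// => l lk.
  by rewrite (e_basis.1 k l) eq_sym (negPf lk) scale0r.
under [RHS]eq_bigr => k _ do rewrite ip_suml scaler_suml.
rewrite exchange_big/=; apply: eq_bigr => i _.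
rewrite {1}aE scaler_sumr; apply: eq_bigr => k _.
by rewrite ipZl scalerA.
Qed.

Lemma projE m : P m = \sum_(i <- zseq m) rank1 (e i) (e i).
Proof.
apply/bopP => h; rewrite bop_sumE; have [Ph hPh] := P_proj m h.
rewrite {1}(basis_section_expand Ph) big_seq [RHS]big_seq.
apply: eq_bigr => i im; rewrite rank1E; congr (_ *: _).
have : ip (h - P m h) (e i) = 0.
  by apply: hPh; apply: linear_span_gen; exists i => //=; rewrite -mem_zseq.
by rewrite ipBl => /eqP; rewrite subr_eq0 => /eqP.
Qed.

Lemma compact_proj m : compact_op (P m).
Proof. by rewrite projE; apply: compact_op_sum => i _; exact: compact_rank1. Qed.

Lemma rnorm_proj_le m h : rnorm (P m h) <= rnorm h.
Proof.
rewrite -(@ler_pXn2r _ 2) ?nnegrE ?rnorm_ge0//.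
have [Ph hPh] := P_proj m h.
have := rnorm_sqD (h - P m h) (P m h); rewrite subrK /reip hPh// mulr0 addr0 => ->.
by rewrite lerDr sqr_ge0.
Qed.

Lemma proj_fix m m' v : (m <= m')%N -> basis_section e m v -> P m' v = v.
Proof.
move=> mm' mv; have [Pv vPv] := P_proj m' v.
have m'v : basis_section e m' v.
  move: mv => [n [c [a [ea ->]]]]; exists n, c, a; split => // i.
  by have [k /= km <-] := ea i; exists k => //=; lia.
apply/esym/eqP; rewrite -subr_eq0; apply/eqP/rnorm0_eq0/eqP.
rewrite -sqrf_eq0 -reip_norm /reip ipBr !vPv// subrr.
by [].
Qed.

(** A finite combination of basis vectors is fixed by [P m] for [m] large; density and contractivity
    extend this to all of [H]. *)
Lemma proj_cvg h (d : R) : 0 < d ->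
  exists N, forall m, (N <= m)%N -> rnorm (h - P m h) < d.
Proof.
move=> d0; have d20 : 0 < d / 2 by lra.
have /dense_rnormP/(_ h _ d20)[v [n [c [a [ea vE]]]] hv] := e_basis.2.
have /boolp.choice[k ak] : forall i, exists k, a i = e k.
  by move=> i; have [k _ <-] := ea i; exists k.
pose N := \max_(i < n) absz (k i).
have vN : basis_section e N v.
  exists n, c, a; split => // i; exists (k i); last by rewrite ak.
  by have := leq_bigmax i (F := fun i => absz (k i)); rewrite /= -/N; lia.
exists N => m Nm; rewrite (le_lt_trans (rnorm_subD v _ _))//.
rewrite [d]splitr ltr_leD// -(proj_fix Nm vN) -linearB (le_trans (rnorm_proj_le _ _))//.
by rewrite rnormB ltW.
Qed.

(** Pointwise convergence of the projections is uniform on a finite net of the image of the unit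
    ball, and contractivity carries it to the whole image. *)
Lemma proj_compact_cvg (f : BH) (d : R) : compact_op f -> 0 < d ->
  exists N, forall m, (N <= m)%N -> rnorm (f - P m * f) <= d.
Proof.
move=> /compact_opP fc d0; have d40 : 0 < d / 4 by lra.
have [s sP] := fc _ d40.
have [N NP] := @seq_eventually _ s (fun v m => rnorm (v - P m v) < d / 4)
  (fun v => proj_cvg v d40).
exists N => m Nm.
have unit_le h : rnorm h <= 1 -> rnorm ((f - P m * f) h) <= d.
  move=> h1; have [v vs vh] := sP _ (ex_intro2 _ _ h h1 erefl).
  have {}NP := NP m Nm v vs.
  rewrite bopBE bopME (le_trans (rnorm_subD v _ _))// rnormB.
  have := rnorm_subD (P m v) v (P m (f h)); rewrite -linearB.
  have := rnorm_proj_le m (v - f h); move: vh NP.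
  move: (rnorm (v - f h)) (rnorm (v - P m v)) (rnorm (P m _)) (rnorm (v - P m _)) => *.
  lra.
rewrite rnorm_bop; apply: ge_sup; first exact: (opnorm_has_sup _).1.
by move=> _ [h /= h1 <-]; exact: unit_le.
Qed.

End BasisProjections.

Section Approximation.
Variables (R : realType) (H : hilbertType R) (e : int -> H) (P : nat -> bounded_op H).
Hypothesis e_basis : orthonormal_basis e.
Hypothesis P_proj : forall m, orthogonal_projection (basis_section e m) (P m).
Local Notation E := (ell2 H).

Lemma ell2_truncate (y : E) (d : R) : 0 < d -> exists J0, forall J, (J0 <= J)%N ->
  rnorm (y - \sum_(j <- zseq J) single j (ell2_compact y j)) <= d.
Proof.
move=> d0; have [F FP] := ell2_tail y (exprn_gt0 2 d0).
have [J0 FJ0] := fset_sub_zseq F; exists J0 => J J0J.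
apply: rnorm_ell2_le => [|G h]; first exact: ltW.
apply: le_trans (FP G h).
have sumE i : (\sum_(j <- zseq J) single j (ell2_compact y j)) i =
    if i \in zseq J then y i else 0.
  rewrite ell2_sumE; case: ifPn => iJ.
    rewrite (bigD1_seq i) ?zseq_uniq//= eqxx big1 ?addr0// => j.
    by rewrite eq_sym => /negPf ->.
  rewrite big_seq big1// => j jJ; rewrite singleE; case: eqP => // ij.
  by rewrite ij jJ in iJ.
rewrite /qsum (_ : \sum_(i <- (G `\` F)%fset) _ =
    \sum_(i <- G | i \notin F) rnorm (y i h) ^+ 2); last first.
  rewrite -[RHS]big_filter; apply: perm_big; apply: uniq_perm.
  - exact: fset_uniq.
  - by rewrite filter_uniq ?fset_uniq.
  - by move=> i; rewrite mem_filter in_fsetD.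
rewrite [leRHS]big_mkcond; apply: ler_sum => i _; rewrite ell2BE sumE bopBE.
case: ifPn => [iZ|iZ]; last first.
  have h0 : (0 : bounded_op H) h = 0 by [].
  rewrite h0 subr0 ifT//; apply: contra iZ => /FJ0; exact: zseq_sub.
by rewrite subrr rnorm0 expr0n; case: ifP => // _; exact: sqr_ge0.
Qed.

(** The factor is the cardinality of $[J]$. The plain triangle inequality is enough, since [J] is
    fixed before [d] is chosen. *)
Lemma rnorm_sum_single_le (J : nat) (f g : int -> bounded_op H)
    (fc : forall j, compact_op (f j)) (gc : forall j, compact_op (g j)) (d : R) :
  (forall j, j \in zseq J -> rnorm (f j - g j) <= d) ->
  rnorm (\sum_(j <- zseq J) single j (fc j) - \sum_(j <- zseq J) single j (gc j))
    <= d *+ (J + J).+1.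
Proof.
move=> fg; rewrite -sumrB (le_trans (rnorm_sum _ _ _))//.
have -> : d *+ (J + J).+1 = \sum_(j <- zseq J) d.
  by rewrite big_const_seq count_predT size_map size_iota iter_addr addr0.
rewrite big_seq [leRHS]big_seq; apply: ler_sum => j /fg; apply: le_trans.
have -> : single j (fc j) - single j (gc j) =
    single j (compact_opD (fc j) (compact_opN (gc j))).
  apply/ell2P => i; rewrite ell2BE !singleE; case: ifP => // _.
  by rewrite subr0.
exact: rnorm_single.
Qed.

Lemma ell2_approx (y : E) (d : R) : 0 < d -> exists J m, [/\ (0 < J)%N, (0 < m)%N &
  rnorm (y - \sum_(j <- zseq J)
    single j (compact_op_mull (P m) (ell2_compact y j))) < d].
Proof.
move=> d0; have d20 : 0 < d / 2 by lra.
have d30 : 0 < d / 3 by lra.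
have [J0 J0P] := ell2_truncate y d30.
(* The successors here and in [N.+1] provide the positive [J] and [m] that assertion (3) quantifies
   over. *)
pose J := J0.+1.
have dJ : 0 < d / 2 / (J + J).+1%:R by rewrite divr_gt0// ltr0n.
have [N NP] := @seq_eventually _ (zseq J)
  (fun j m => rnorm (y j - P m * y j) <= d / 2 / (J + J).+1%:R)
  (fun j => proj_compact_cvg e_basis P_proj (ell2_compact y j) dJ).
exists J, N.+1; split => //.
rewrite (le_lt_trans (rnorm_subD (\sum_(j <- zseq J) single j (ell2_compact y j)) _ _))//.
have := J0P J (leqnSn _).
have := rnorm_sum_single_le (ell2_compact y)
  (fun j => compact_op_mull (P N.+1) (ell2_compact y j)) (NP N.+1 (leqnSn _)).
rewrite -[X in _ <= X -> _]mulr_natr divfK ?pnatr_eq0//.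
by move: (rnorm _) (rnorm _) => a b; lra.
Qed.

End Approximation.

(** * Separability *)

Section SeparableSets.
Variables (R : realType) (X : normedModType R[i]).

Definition separable_set (A : set X) := exists c : nat -> X,
  forall a, A a -> forall d : R, 0 < d -> exists n, rnorm (a - c n) < d.

Lemma separable_count (I : countType) (c : I -> X) (A : set X) :
  (forall a, A a -> forall d : R, 0 < d -> exists i, rnorm (a - c i) < d) ->
  separable_set A.
Proof.
move=> Ac; exists (fun n : nat => oapp c 0 (choice.unpickle n)) => a Aa d d0.
by have [i ai] := Ac a Aa d d0; exists (choice.pickle i); rewrite choice.pickleK.
Qed.

Lemma separable_sum (I : Type) (s : seq I) (A : I -> set X) :
  (forall i, separable_set (A i)) ->
  separable_set [set x | exists2 f : I -> X, (forall i, A i (f i)) &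
                          x = \sum_(i <- s) f i].
Proof.
move=> sA; elim: s => [|i s [c cP]].
  exists (fun=> 0) => _ [f _ ->] d d0; exists 0%N.
  by rewrite big_nil subr0 rnorm0.
have [b bP] := sA i.
apply: (@separable_count _ (fun nm : nat * nat => b nm.1 + c nm.2)) => _ [f fA ->] d d0.
have d20 : 0 < d / 2 by lra.
have [n nP] := bP _ (fA i) _ d20.
have [|m mP] := cP (\sum_(k <- s) f k) _ _ d20; first by exists f.
exists (n, m); rewrite big_cons opprD addrACA (le_lt_trans (rnormD _ _))//.
by rewrite [d]splitr ltrD.
Qed.

Lemma separable_bigcup (A : nat -> set X) :
  (forall n, separable_set (A n)) -> separable_set (\bigcup_n A n).
Proof.
move=> /boolp.choice[c cP].
apply: (@separable_count _ (fun nm : nat * nat => c nm.1 nm.2)) => a [n _ Aa] d d0.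
by have [m mP] := cP n a Aa d d0; exists (n, m).
Qed.

Lemma separable_approx (A B : set X) : separable_set A ->
  (forall b, B b -> forall d : R, 0 < d -> exists2 a, A a & rnorm (b - a) < d) ->
  separable_set B.
Proof.
move=> [c cP] BA; exists c => b Bb d d0; have d20 : 0 < d / 2 by lra.
have [a Aa ba] := BA b Bb _ d20; have [n nP] := cP a Aa _ d20.
by exists n; rewrite (le_lt_trans (rnorm_subD a _ _))// [d]splitr ltrD.
Qed.

Lemma separable_line (u : X) : separable_set (range (fun a : R[i] => a *: u)).
Proof.
apply: (@separable_count _ (fun q : rat * rat => (ratr q.1 +i* ratr q.2 : R[i]) *: u)).
move=> _ [[a b] _ <-] d d0.
have u0 : 0 < rnorm u + 1 by rewrite ltr_wpDl ?rnorm_ge0.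
set t := d / (rnorm u + 1) / 2.
have t0 : 0 < t by rewrite !divr_gt0.
have ratP (r : R) : exists q : rat, `|r - ratr q| < t.
  have [|q] := @rat_in_itvoo R (r - t) (r + t); first by lra.
  rewrite in_itv/= => /andP[q1 q2]; exists q; rewrite ltr_norml; lra.
have [p ap] := ratP a; have [q bq] := ratP b; exists (p, q).
rewrite -scalerBl rnormZ; set z := (X in complex.Re `|X|).
have zE : z = (a - ratr p) +i* (b - ratr q) by [].
have : complex.Re `|z| < d / (rnorm u + 1).
  rewrite zE (le_lt_trans (normc_le _ _))// (_ : d / (rnorm u + 1) = t + t) ?ltrD//.
  by rewrite /t; lra.
rewrite ltr_pdivlMr//; apply: le_lt_trans.
by rewrite ler_wpM2l ?lerDl//; exact: (rnorm_ge0 (z : R[i]^o)).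
Qed.

End SeparableSets.

Lemma separable_image (R : realType) (X Y : normedModType R[i]) (A : set X)
    (f : X -> Y) (M : R) : 0 <= M ->
  (forall x y, rnorm (f x - f y) <= M * rnorm (x - y)) ->
  separable_set A -> separable_set (f @` A).
Proof.
move=> M0 fM [c cP]; exists (f \o c) => _ [a Aa <-] d d0.
have M1 : 0 < M + 1 by lra.
have [n nP] := cP a Aa _ (divr_gt0 d0 M1); exists n.
rewrite (le_lt_trans (fM _ _))//; move: nP; rewrite ltr_pdivlMr// mulrC.
by apply: le_lt_trans; rewrite ler_wpM2r ?rnorm_ge0// lerDl.
Qed.

Section Separability.
Variables (R : realType) (H : hilbertType R) (e : int -> H) (P : nat -> bounded_op H).
Hypothesis e_basis : orthonormal_basis e.
Hypothesis P_proj : forall m, orthogonal_projection (basis_section e m) (P m).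
Local Notation E := (ell2 H).

Lemma separable_hilbert : separable_set [set: H].
Proof.
pose A m := [set x | exists2 f : int -> H,
  (forall i, range (fun a : R[i] => a *: e i) (f i)) & x = \sum_(i <- zseq m) f i].
apply: (@separable_approx _ _ (\bigcup_m A m)).
  apply: separable_bigcup => m.
  apply: (@separable_sum _ _ _ (zseq m) (fun i => range (fun a : R[i] => a *: e i))) => i.
  exact: separable_line.
move=> h _ d d0; have [N NP] := proj_cvg e_basis P_proj h d0.
exists (P N h); last exact: (NP N (leqnn N)).
exists N => //; exists (fun i => ip h (e i) *: e i); first by move=> i; exists (ip h (e i)).
by rewrite (projE e_basis P_proj) bop_sumE.
Qed.

(** The approximants have entries $P_my_j=\sum_i e_i\otimes(y_j^*e_i)^*$: finite sums of rank-one
    operators depending in a Lipschitz way on vectors of the separable space [H]. *)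
Lemma separable_ell2 : separable_set [set: E].
Proof.
pose B j i := range (fun g : H => single j (compact_rank1 (e i) g)).
pose C j m := [set x : E | exists2 f : int -> E, (forall i, B j i (f i)) &
  x = \sum_(i <- zseq m) f i].
pose A (J m : nat) := [set x : E | exists2 f : int -> E, (forall j, C j m (f j)) &
  x = \sum_(j <- zseq J) f j].
apply: (@separable_approx _ _ (\bigcup_J \bigcup_m A J m)).
  apply: separable_bigcup => J; apply: separable_bigcup => m.
  apply: (@separable_sum _ _ _ (zseq J) (fun j => C j m)) => j.
  apply: (@separable_sum _ _ _ (zseq m) (B j)) => i.
  apply: (@separable_image _ _ _ _ _ (rnorm (e i))) separable_hilbert.
    exact: rnorm_ge0.
  move=> g g'.
  have -> : single j (compact_rank1 (e i) g) - single j (compact_rank1 (e i) g') =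
      single j (compact_rank1 (e i) (g - g')).
    apply/ell2P => k; rewrite ell2BE !singleE; case: ifP => _; last by rewrite subr0.
    exact: rank1B.
  by rewrite mulrC (le_trans (rnorm_single _ _))// rnorm_rank1.
move=> y _ d d0; have [J [m [_ _ ym]]] := ell2_approx e_basis P_proj y d0.
eexists; last exact: ym.
exists J => //; exists m => //.
exists (fun j => single j (compact_op_mull (P m) (ell2_compact y j))) => // j.
exists (fun i => single j (compact_rank1 (e i) (adj (y j) (e i)))).
  by move=> i; exists (adj (y j) (e i)).
apply/ell2P => k; rewrite ell2_sumE singleE; case: eqP => [->|kj]; last first.
  by rewrite big1// => i _; rewrite singleE; case: eqP.
apply/bopP => h; rewrite bop_sumE bopME (projE e_basis P_proj) bop_sumE.
by apply: eq_bigr => i _; rewrite singleE eqxx !rank1E adjP.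
Qed.

End Separability.

(** * Weighted shifts *)

Lemma iter_period (T : Type) (f : T -> T) (x : T) p n :
  (p %| n)%N -> iter p f x = x -> iter n f x = x.
Proof.
move=> /dvdnP[q ->] px; elim: q => // q IH.
by rewrite mulSn iterD IH.
Qed.

(** The dense sequence must lie in [X0]: every [c n] is replaced by points of [X0] within $1/(q+1)$
    of it, one for each [q]. *)
Lemma dense_separable_seq (R : realType) (X : normedModType R[i]) (X0 : set X) :
  separable_set [set: X] -> dense X0 -> exists2 z : nat -> X, (forall i, X0 (z i)) &
    forall x (d : R), 0 < d -> exists i, rnorm (x - z i) < d.
Proof.
move=> [c cP] /dense_rnormP dX0.
have q0 (q : nat) : 0 < (q.+1%:R^-1 : R) by rewrite invr_gt0 ltr0n.
have /boolp.choice[z zP] : forall nq : nat * nat, exists z,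
    X0 z /\ rnorm (c nq.1 - z) < nq.2.+1%:R^-1.
  by move=> [n q]; have [z zX zc] := dX0 (c n) _ (q0 q); exists z.
exists (fun i => z (odflt (0%N, 0%N) (choice.unpickle i))) => [i|x d d0].
  exact: (zP _).1.
have d20 : 0 < d / 2 by lra.
have [n nP] := cP x I _ d20.
pose q := Num.truncn (d / 2)^-1.
exists (choice.pickle (n, q)); rewrite choice.pickleK /=.
rewrite (le_lt_trans (rnorm_subD (c n) _ _))// [d]splitr ltrD//.
rewrite (lt_le_trans (zP (n, q)).2)//= invf_ple ?posrE ?ltr0n//.
by rewrite ltW// truncnS_gt.
Qed.

Lemma criterion_consequences (R : realType) (X : normedModType R[i])
    (T : {linear X -> X}) (M : R) (X0 : set X) (S : X -> X) :
  0 <= M -> (forall x, rnorm (T x) <= M * rnorm x) ->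
  sequentially_complete X -> separable_set [set: X] ->
  dense X0 -> (forall x, X0 x -> X0 (S x)) ->
  (forall x, X0 x -> [/\ unconditionally_cauchy (fun n => iter n T x),
                         unconditionally_cauchy (fun n => iter n S x) & T (S x) = x]) ->
  [/\ chaotic T, frequently_hypercyclic T & topologically_mixing T].
Proof.
move=> M0 TM cX sX dX0 SX0 ucX0.
have Tu x : X0 x -> unconditionally_cauchy (fun n => iter n T x) by move=> /ucX0[].
have Su x : X0 x -> unconditionally_cauchy (fun n => iter n S x) by move=> /ucX0[].
have TS x : X0 x -> T (S x) = x by move=> /ucX0[].
have [z zX0 z_dense] := dense_separable_seq sX dX0.
have fT : frequently_hypercyclic T.
  exact: (criterion_frequently_hypercyclic M0 TM SX0 Tu Su TS cX zX0 z_dense).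
split=> //; last exact: (criterion_mixing dX0 SX0 Tu Su TS).
split; first exact: frequently_hypercyclic_hypercyclic.
exact: (criterion_periodic M0 TM dX0 SX0 Tu Su TS cX).
Qed.

Lemma eq_cvg_in_B0 (R : realType) (H : hilbertType R) (u v : nat -> bounded_op H) :
  u =1 v -> cvg_in_B0 (u @ \oo) -> cvg_in_B0 (v @ \oo).
Proof. by move=> /funext ->. Qed.

Section Shifts.
Variables (R : realType) (H : hilbertType R).
Local Notation BH := (bounded_op H).
Local Notation E := (ell2 H).

(* The forward and backward shifts are the cases [s = 1] and [s = -1]. *)
Variables (s : int) (V : int -> BH) (A : {linear E -> E}).
Hypotheses (s0 : s != 0) (AE : forall x n, A x n = V n * x (n - s)).
Hypothesis V_bounded : uniformly_bounded V.

(** The weights met on the way from [j] to [j + s * n], the last one leftmost. *)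
Fixpoint weight_prod (j : int) (n : nat) : BH :=
  if n is n'.+1 then V (j + s * n'.+1%:Z) * weight_prod j n' else 1.

Lemma iter_shiftE n x j : iter n A x (j + s * n%:Z) = weight_prod j n * x j.
Proof.
elim: n => [|n IH] /=; first by rewrite mulr0 addr0 mul1r.
by rewrite AE intS mulrDr mulr1 (addrC s) addrA addrK IH mulrA.
Qed.

Lemma iter_shift_single n j f (fc : compact_op f) :
  iter n A (single j fc) =
  single (j + s * n%:Z) (compact_op_mull (weight_prod j n) fc).
Proof.
apply/ell2P => i; rewrite -(subrK (s * n%:Z) i) iter_shiftE !singleE.
rewrite (inj_eq (addIr _)); case: eqP => [->//|_]; exact: mulr0.
Qed.

Lemma shift_pos_inj (j : int) n : (0 < n)%N ->
  injective (fun l : nat => j + s * (l * n)%N%:Z).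
Proof.
move=> n0 l k /addrI/(mulfI s0)/eqP; rewrite eqz_nat eqn_pmul2r//.
by move/eqP.
Qed.

Lemma shift_bounded : exists2 M : R, 0 <= M & forall x, rnorm (A x) <= M * rnorm x.
Proof.
have [M VM] := V_bounded.
have M0 : 0 <= M by rewrite (le_trans (rnorm_ge0 (V 0))).
exists M => // x; apply: rnorm_ell2_le => [|F h]; first by rewrite mulr_ge0 ?rnorm_ge0.
rewrite exprMn -mulrA.
apply: le_trans (ler_wpM2l (sqr_ge0 M) (qsum_rnorm x [fset j - s | j in F]%fset h)).
rewrite /qsum big_imfset/=; last by move=> i j _ _ /addIr.
rewrite mulr_sumr; apply: ler_sum => j _; rewrite AE bopME -exprMn.
rewrite ler_pXn2r ?nnegrE ?mulr_ge0 ?rnorm_ge0// (le_trans (rnorm_bopP _ _))//.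
by rewrite ler_wpM2r ?rnorm_ge0.
Qed.

Lemma periodic_series_cvg x n j : (0 < n)%N -> iter n A x = x ->
  cvg_in_B0 (\sum_(1 <= l < N.+1)
    adj (weight_prod j (l * n) * x j) * (weight_prod j (l * n) * x j) @[N --> \oo]).
Proof.
move=> n0 nx; apply: eq_cvg_in_B0 (ell2_subseries_cvg x (@shift_pos_inj j n n0)).
move=> N; apply: eq_bigr => l _.
by rewrite -iter_shiftE (iter_period _ nx) ?dvdn_mull.
Qed.

Lemma rnorm_weight_prod (C : R) j n r h : 0 <= C -> (forall i, rnorm (V i) <= C) ->
  rnorm (weight_prod j (r + n) h) <= C ^+ r * rnorm (weight_prod j n h).
Proof.
move=> C0 VC; elim: r => [|r IH]; first by rewrite expr0 mul1r.
rewrite addSn /= (le_trans (rnorm_bopP _ _))// exprS -mulrA.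
by apply: ler_pM => //; exact: rnorm_ge0.
Qed.

(* Convergence along the multiples of [n] suffices: the terms with index in
   [[q n, (q + 1) n[] are controlled by the one of index [q n]. *)
Lemma square_summable_weight_prod (D : BH) j n : (0 < n)%N ->
  cvg_in_B0 (\sum_(1 <= l < N.+1)
    adj (weight_prod j (l * n) * D) * (weight_prod j (l * n) * D) @[N --> \oo]) ->
  square_summable (fun d => weight_prod j d * D).
Proof.
move=> n0 /cvg_square_summable sD e e0; have [M VM] := V_bounded.
(* A bound at least 1, so that $C^r\le C^n$ for every remainder $r<n$. *)
pose C := M + 1; have C1 : 1 <= C.
  by rewrite lerDr (le_trans (rnorm_ge0 (V 0))).
have C0 : 0 <= C by rewrite (le_trans _ C1).
have VC i : rnorm (V i) <= C by rewrite (le_trans (VM i))// lerDl.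
(* Each quotient accounts for at most [n] indices, each costing a factor $C^{2n}$. *)
pose K := (C ^+ n) ^+ 2 * n%:R.
have K0 : 0 < K by rewrite mulr_gt0 ?ltr0n// !exprn_gt0// (lt_le_trans ltr01).
have [N NP] := sD _ (divr_gt0 e0 K0); exists (N * n)%N => r ur Nr h.
pose a q := rnorm ((weight_prod j (q * n) * D) h) ^+ 2.
have [B le1] := @ler_sum_divn _ a _ _ _ n0 (fun q => sqr_ge0 _) ur Nr.
have le2 : \sum_(N <= q < B) a q <= e / K * rnorm h ^+ 2.
  apply: NP; first exact: iota_uniq.
  by apply/allP => q; rewrite mem_index_iota => /andP[].
apply: (@le_trans _ _ ((C ^+ n) ^+ 2 * \sum_(d <- r) a (d %/ n)%N)).
  rewrite mulr_sumr; apply: ler_sum => d _; rewrite -exprMn.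
  rewrite ler_pXn2r ?nnegrE ?mulr_ge0 ?rnorm_ge0 ?exprn_ge0//.
  rewrite !bopME {1}(divn_eq d n) addnC (le_trans (rnorm_weight_prod _ _ _ _ C0 VC))//.
  by rewrite ler_wpM2r ?rnorm_ge0// ler_weXn2l// ltnW// ltn_mod.
apply: (@le_trans _ _ ((C ^+ n) ^+ 2 * ((e / K * rnorm h ^+ 2) *+ n))).
  by rewrite ler_wpM2l ?sqr_ge0// (le_trans le1)// lerMn2r le2 orbT.
rewrite le_eqVlt; apply/orP; left; apply/eqP.
rewrite -mulr_natr.
have -> : (C ^+ n) ^+ 2 * (e / K * rnorm h ^+ 2 * n%:R) = K * (e / K) * rnorm h ^+ 2.
  by rewrite /K; ring.
by rewrite (mulrCA K e) divff ?mulr1// gt_eqF.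
Qed.

(** The weights act on the left, so the estimate for [D] at the vector [f h] is the estimate for
    [D * f] at [h], up to $\|f\|^2$. *)
Lemma unconditionally_cauchy_shift_single (D : BH) j n f (fc : compact_op f) :
  (0 < n)%N ->
  cvg_in_B0 (\sum_(1 <= l < N.+1)
    adj (weight_prod j (l * n) * D) * (weight_prod j (l * n) * D) @[N --> \oo]) ->
  unconditionally_cauchy (fun d => iter d A (single j (compact_op_mull D fc))).
Proof.
move=> n0 /(square_summable_weight_prod n0) sD.
have sDf : square_summable (fun d => weight_prod j d * (D * f)).
  move=> e e0; have f1 : 0 < rnorm f ^+ 2 + 1 by rewrite ltr_wpDl ?sqr_ge0.
  have [N NP] := sD _ (divr_gt0 e0 f1); exists N => r ur Nr h.
  apply: le_trans (NP r ur Nr (f h)) _.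
  apply: (@le_trans _ _ (e / (rnorm f ^+ 2 + 1) * ((rnorm f ^+ 2 + 1) * rnorm h ^+ 2))).
    rewrite ler_wpM2l ?(ltW (divr_gt0 e0 f1))//.
    apply: (@le_trans _ _ ((rnorm f * rnorm h) ^+ 2)).
      by rewrite ler_pXn2r ?nnegrE ?mulr_ge0 ?rnorm_ge0// rnorm_bopP.
    by rewrite exprMn ler_wpM2r ?sqr_ge0// lerDl.
  by rewrite mulrA divfK// gt_eqF.
have pos_inj : injective (fun l : nat => j + s * l%:Z).
  by move=> l k /addrI/(mulfI s0) [].
have := unconditionally_cauchy_single
  (fun d => compact_op_mull (weight_prod j d) (compact_op_mull D fc)) pos_inj sDf.
by congr unconditionally_cauchy; apply/funext => d; rewrite iter_shift_single.
Qed.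

End Shifts.

Section WeightedShift.
Variables (R : realType) (H : hilbertType R).
Local Notation BH := (bounded_op H).
Local Notation E := (ell2 H).

Lemma ell2ZE (x : E) a j : (a *: x) j = a *: x j. Proof. by []. Qed.

Lemma bopMZ (f g : BH) a : f * (a *: g) = a *: (f * g).
Proof. by apply/bopP => h; rewrite bopZE !bopME bopZE linearZ. Qed.

Fact weighted_shift_linear (W : int -> BH) (bW : uniformly_bounded W) :
  linear (weighted_shift bW).
Proof.
move=> a x y; apply/ell2P => n.
by rewrite ell2DE ell2ZE !weighted_shiftE ell2DE ell2ZE mulrDr bopMZ.
Qed.

HB.instance Definition _ (W : int -> BH) (bW : uniformly_bounded W) :=
  GRing.isLinear.Build R[i] E E _ (weighted_shift bW) (weighted_shift_linear bW).

Lemma qtail_shiftN (x : int -> BH) : qtail x -> qtail (fun j => x (j + 1)).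
Proof.
move=> tx e e0; have [F FP] := tx _ e0.
exists [fset (j - 1)%R | j in F]%fset => G h.
apply: le_trans (FP [fset (j + 1)%R | j in G]%fset h).
rewrite /qsum -(big_map (fun j => j + 1) xpredT (fun j => rnorm (x j h) ^+ 2)).
apply: ler_sum_uniq_subseq => [||j|j]; last exact: sqr_ge0.
- by rewrite map_inj_uniq ?fset_uniq//; exact: addIr.
- exact: fset_uniq.
move=> /mapP[k]; rewrite in_fsetD => /andP[kF kG] ->.
rewrite in_fsetD; apply/andP; split; last by apply/imfsetP; exists k.
by apply: contra kF => kF; apply/imfsetP; exists (k + 1); rewrite //= addrK.
Qed.

Fact backward_shift_tail (V : int -> BH) : uniformly_bounded V ->
  forall x : E, qtail (fun n => V (n + 1) * x (n + 1)).
Proof.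
move=> [M VM] x; apply: (@qtail_le _ _ (fun n => x (n + 1)) _ M).
- by rewrite (le_trans _ (VM 0))// rnorm_ge0.
- move=> j h; rewrite bopME (le_trans (rnorm_bopP _ _))//.
  by rewrite ler_wpM2r ?rnorm_ge0.
- exact/qtail_shiftN/ell2_tail.
Qed.

(** For [V] the inverse weights this is $T_W^{-1}$. In the common form of the shifts, with [s = -1],
    its weights are [fun i => V (i + 1)]. *)
Definition backward_shift (V : int -> BH) (bV : uniformly_bounded V) (x : E) : E :=
  mk_ell2 (fun n => compact_op_mull (V (n + 1)) (ell2_compact x (n + 1)))
    (backward_shift_tail bV x).

Lemma backward_shiftE (V : int -> BH) (bV : uniformly_bounded V) (x : E) n :
  backward_shift bV x n = V (n + 1) * x (n + 1).
Proof. by []. Qed.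

Fact backward_shift_linear (V : int -> BH) (bV : uniformly_bounded V) :
  linear (backward_shift bV).
Proof.
move=> a x y; apply/ell2P => n.
by rewrite ell2DE ell2ZE !backward_shiftE ell2DE ell2ZE mulrDr bopMZ.
Qed.

HB.instance Definition _ (V : int -> BH) (bV : uniformly_bounded V) :=
  GRing.isLinear.Build R[i] E E _ (backward_shift bV) (backward_shift_linear bV).

Lemma weighted_shift_shiftE (W : int -> BH) (bW : uniformly_bounded W) (x : E) n :
  weighted_shift bW x n = W n * x (n - 1).
Proof. exact: weighted_shiftE. Qed.

Lemma backward_shift_shiftE (V : int -> BH) (bV : uniformly_bounded V) (x : E) n :
  backward_shift bV x n = V (n + 1) * x (n - (-1)).
Proof. by rewrite opprK backward_shiftE. Qed.

Lemma adj1 : adj (1 : BH) = 1.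
Proof. exact: adj_uniq. Qed.

(** Brings (i) to the form $\sum_l A_l^*A_l$ to which the quadratic-form estimates apply. The weight
    product grows on the left and its adjoint on the right, hence the two opposite recursions. *)
Lemma forward_termE (W : int -> BH) D j n : forward_term W D j n =
  adj (weight_prod 1 W j n * D) * (weight_prod 1 W j n * D).
Proof.
have -> : weight_prod 1 W j n = \prod_(i < n) W (j + n%:Z - i%:Z).
  elim: n => [|n IH]; first by rewrite big_ord0.
  rewrite big_ord_recl /= mul1r subr0 IH; congr (_ * _).
  by apply: eq_bigr => i _; congr (W _); rewrite /bump /=; lia.
rewrite adjM /forward_term !mulrA; congr (_ * _ * _ * _).
elim: n => [|n IH]; first by rewrite !big_ord0 adj1.
rewrite big_ord_recr [in RHS]big_ord_recl adjM /= subr0; congr (_ * _).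
rewrite IH; congr adj; apply: eq_bigr => i _; congr (W _).
by rewrite /bump /=; lia.
Qed.

Lemma backward_termE (V : int -> BH) D j n : backward_term V D j n =
  adj (weight_prod (-1) (fun i => V (i + 1)) j n * D) *
  (weight_prod (-1) (fun i => V (i + 1)) j n * D).
Proof.
have -> : weight_prod (-1) (fun i => V (i + 1)) j n =
    \prod_(i < n) V (j - n%:Z + i.+1%:Z).
  elim: n => [|n IH]; first by rewrite big_ord0.
  rewrite big_ord_recl /= IH mulN1r; congr (_ * _).
  by apply: eq_bigr => i _; congr (V _); rewrite /bump /=; lia.
rewrite adjM /backward_term !mulrA; congr (_ * _ * _ * _).
elim: n => [|n IH]; first by rewrite !big_ord0 adj1.
rewrite big_ord_recr [in RHS]big_ord_recl adjM /= IH; congr (adj _ * adj _).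
  by apply: eq_bigr => i _; congr (V _); rewrite /bump /=; lia.
by congr (V _); lia.
Qed.

End WeightedShift.

Lemma eq_unconditionally_cauchy (R : realType) (X : normedModType R[i]) (u v : nat -> X) :
  u =1 v -> unconditionally_cauchy u -> unconditionally_cauchy v.
Proof. by move=> /funext ->. Qed.

(** * The implications between the three assertions *)

Section WeightedShiftChaos.
Variables (R : realType) (H : hilbertType R) (e : int -> H)
  (P : nat -> bounded_op H) (W Winv : int -> bounded_op H).
Hypotheses (e_basis : orthonormal_basis e)
  (P_proj : forall m, orthogonal_projection (basis_section e m) (P m))
  (W_invl : forall j, Winv j * W j = 1) (W_invr : forall j, W j * Winv j = 1)
  (W_bounded : uniformly_bounded W) (Winv_bounded : uniformly_bounded Winv).
Local Notation T := (weighted_shift W_bounded).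
Local Notation S := (backward_shift Winv_bounded).
Local Notation E := (ell2 H).

(** Assertion (3), named so that the implications can be stated separately. *)
Definition series_condition : Prop := forall J m : nat, (0 < J)%N -> (0 < m)%N ->
  exists (n : nat -> nat) (D : int -> nat -> bounded_op H),
    [/\ forall k, (0 < n k)%N,
        {homo n : k k' / (k < k')%N},
        forall (j : int) k, - J%:Z <= j <= J%:Z -> compact_op (D j k) &
        forall j : int, - J%:Z <= j <= J%:Z ->
        [/\ rnorm (D j k - P m) @[k --> \oo] --> (0 : R),
            forall k, cvg_in_B0
              (\sum_(1 <= l < N.+1) forward_term W (D j k) j (l * n k)
                @[N --> \oo]) &
            forall k, cvg_in_B0
              (\sum_(1 <= l < N.+1) backward_term Winv (D j k) j (l * n k)
                @[N --> \oo])]].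

(** The largest set on which the criterion can hold with $S=T_W^{-1}$: stability under [S] is
    formal, and all the content lies in its density. *)
Definition summable_orbits : set E :=
  [set x | unconditionally_cauchy (fun n => iter n T x) /\
           unconditionally_cauchy (fun n => iter n S x)].

Lemma weighted_shiftK x : T (S x) = x.
Proof.
apply/ell2P => n; rewrite weighted_shiftE backward_shiftE subrK mulrA W_invr.
exact: mul1r.
Qed.

Lemma backward_shiftK x : S (T x) = x.
Proof.
apply/ell2P => n; rewrite backward_shiftE weighted_shiftE addrK mulrA W_invl.
exact: mul1r.
Qed.

Lemma iter_backward_shiftK n x : iter n S (iter n T x) = x.
Proof. by elim: n x => // n IH x; rewrite iterSr/= backward_shiftK. Qed.

Lemma summable_orbits_stable x : summable_orbits x -> summable_orbits (S x).
Proof.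
move=> [Tx Sx]; split.
  apply: unconditionally_cauchy_shift; move: Tx; congr unconditionally_cauchy.
  by apply/funext => n; rewrite iterSr weighted_shiftK.
have := unconditionally_cauchy_subseq Sx succn_inj leqnSn.
by congr unconditionally_cauchy; apply/funext => n; rewrite /= -iterSr.
Qed.

Lemma dense_periodic_series_condition :
  dense (periodic_points T) -> series_condition.
Proof.
move=> /dense_rnormP dT J m J0 m0.
pose y := \sum_(j <- zseq J) single j (compact_proj e_basis P_proj m).
have yE j : j \in zseq J -> y j = P m.
  move=> jJ; rewrite /y ell2_sumE (bigD1_seq j) ?zseq_uniq//= eqxx big1 ?addr0// => i.
  by rewrite eq_sym => /negPf ->.
have k0 (k : nat) : 0 < (k.+1%:R^-1 : R) by rewrite invr_gt0 ltr0n.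
have /boolp.choice[xp xpP] : forall k : nat, exists xp : E * nat,
    [/\ (0 < xp.2)%N, iter xp.2 T xp.1 = xp.1 & rnorm (y - xp.1) < k.+1%:R^-1].
  by move=> k; have [x [p p0 px] yx] := dT y _ (k0 k); exists (x, p).
(* A common multiple of the periods met so far remains a period of the current point; the factor
   [k.+1] forces strict growth. *)
pose n k := (k.+1 * \prod_(i < k.+1) (xp i).2)%N.
have prod_gt0 k : (0 < \prod_(i < k) (xp i).2)%N.
  by rewrite prodn_gt0// => i; have [] := xpP i.
have n0 k : (0 < n k)%N by rewrite muln_gt0 prod_gt0.
have nx k : iter (n k) T (xp k).1 = (xp k).1.
  have [_ px _] := xpP k; apply: iter_period px.
  by rewrite dvdn_mull// big_ord_recr/= dvdn_mull.
exists n, (fun j k => (xp k).1 j); split=> // [k k'|j k _|j jJ].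
- suff nS k1 : (n k1 < n k1.+1)%N.
    by apply: (@homo_ltn _ n (fun a b => (a < b)%N)) => // b a c; exact: ltn_trans.
  rewrite /n [X in (_ < _ * X)%N]big_ord_recr/=.
  rewrite (@leq_trans (k1.+2 * \prod_(i < k1.+1) (xp i).2))//.
    by rewrite ltn_mul2r prod_gt0 ltnSn.
  by rewrite leq_mul2l/= leq_pmulr//; have [] := xpP k1.+1.
- exact: ell2_compact.
split=> [|k|k].
- apply/cvgrPdist_lt => d d0; exists (Num.truncn d^-1) => // k /= kd.
  rewrite sub0r normrN ger0_norm ?rnorm_ge0// rnormB -(yE j) ?mem_zseq// -ell2BE.
  rewrite (le_lt_trans (rnorm_ell2_coord _ _))//.
  have [_ _] := xpP k; move=> /lt_trans; apply.
  rewrite invf_plt ?posrE ?ltr0n//; apply: lt_le_trans (truncnS_gt _) _.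
  by rewrite ler_nat.
- have := @periodic_series_cvg _ _ 1 W T isT (weighted_shift_shiftE W_bounded)
    (xp k).1 _ j (n0 k) (nx k).
  apply: eq_cvg_in_B0 => N; apply: eq_bigr => l _.
  by rewrite forward_termE.
(* Since [S] inverts [T], a period for [T] is one for [S]; the series (ii) is thus handled as (i),
   in the other direction. *)
- have Snx : iter (n k) S (xp k).1 = (xp k).1.
    by rewrite -[in LHS](nx k) iter_backward_shiftK.
  have := @periodic_series_cvg _ _ (-1) (fun i => Winv (i + 1)) S isT
    (backward_shift_shiftE Winv_bounded) (xp k).1 _ j (n0 k) Snx.
  apply: eq_cvg_in_B0 => N; apply: eq_bigr => l _.
  by rewrite backward_termE.
Qed.

Lemma Winv1_bounded : uniformly_bounded (fun i => Winv (i + 1)).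
Proof. by have [M WM] := Winv_bounded; exists M. Qed.

Lemma series_condition_dense : series_condition -> dense summable_orbits.
Proof.
move=> cond; apply/dense_rnormP => y d d0; have d20 : 0 < d / 2 by lra.
have [J [m [J0 m0 ym]]] := ell2_approx e_basis P_proj y d20.
have [n [D [n0 _ _ Dj]]] := cond J m J0 m0.
(* Absorbs the number of positions and the right factors $y_j$, whose norms are at most $\|y\|$;
   adding 1 avoids dividing by zero. *)
pose c := d / 2 / (J + J).+1%:R / (rnorm y + 1).
have y1 : 0 < rnorm y + 1 by rewrite ltr_wpDl ?rnorm_ge0.
have c0 : 0 < c by rewrite !divr_gt0// ltr0n.
(* [seq_eventually] wants a threshold for every [j]; the repeated membership makes the property
   vacuous outside $[J]$. *)
have [N NP] : exists N, forall k, (N <= k)%N -> forall j, j \in zseq J ->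
    j \in zseq J -> rnorm (D j k - P m) <= c.
  apply: seq_eventually => j; have [jJ|jJ] := boolP (j \in zseq J); last by exists 0%N.
  have /Dj[+ _ _] : - J%:Z <= j <= J%:Z by rewrite -mem_zseq.
  move=> /cvgrPdist_lt/(_ _ c0)[N _ NP]; exists N => k /NP /=.
  by rewrite sub0r normrN ger0_norm ?rnorm_ge0// => /ltW.
pose Dy j := compact_op_mull (D j N) (ell2_compact y j).
exists (\sum_(j <- zseq J) single j (Dy j)).
  rewrite big_seq; elim/big_ind : _ => [|u v [Tu Su] [Tv Sv]|j jJ].
  - have iter0 (A : {linear E -> E}) : unconditionally_cauchy (fun k => iter k A 0).
      apply: (eq_unconditionally_cauchy _ (@unconditionally_cauchy0 _ E)) => k.
      by elim: k => //= k <-; rewrite linear0.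
    by split; exact: iter0.
  - split.
      apply: (eq_unconditionally_cauchy _ (unconditionally_cauchyD Tu Tv)) => k.
      by rewrite iterlD.
    apply: (eq_unconditionally_cauchy _ (unconditionally_cauchyD Su Sv)) => k.
    by rewrite iterlD.
  move: jJ; rewrite mem_zseq => /Dj[_ fw bw].
  split.
    apply: (@unconditionally_cauchy_shift_single _ _ 1 W T isT
      (weighted_shift_shiftE W_bounded) W_bounded _ j _ _ _ (n0 N)).
    by apply: eq_cvg_in_B0 (fw N) => B; apply: eq_bigr => l _; rewrite forward_termE.
  apply: (@unconditionally_cauchy_shift_single _ _ (-1) (fun i => Winv (i + 1)) S isT
    (backward_shift_shiftE Winv_bounded) Winv1_bounded _ j _ _ _ (n0 N)).
  by apply: eq_cvg_in_B0 (bw N) => B; apply: eq_bigr => l _; rewrite backward_termE.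
rewrite [d]splitr; apply: le_lt_trans (rnorm_subD _ _ _) (ltr_leD ym _).
rewrite rnormB; have Dy_le j : j \in zseq J ->
    rnorm (D j N * y j - P m * y j) <= d / 2 / (J + J).+1%:R.
  move=> jJ; rewrite -mulrBl (le_trans (rnorm_bopM _ _))//.
  rewrite -(divfK (lt0r_neq0 y1) (d / 2 / _)) -/c.
  apply: ler_pM; rewrite ?rnorm_ge0//; first exact: (NP N).
  by rewrite (le_trans (rnorm_ell2_coord _ _))// lerDl.
rewrite (le_trans (rnorm_sum_single_le Dy
  (fun j => compact_op_mull (P m) (ell2_compact y j)) Dy_le))//.
by rewrite -[leLHS]mulr_natr divfK ?pnatr_eq0.
Qed.

Lemma series_condition_criterion : series_condition ->
  frequent_hypercyclicity_criterion T.
Proof.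
move=> /series_condition_dense dX0; exists summable_orbits, S; split=> //.
  exact: summable_orbits_stable.
move=> x [Tx Sx]; split; last exact: weighted_shiftK.
  exact: (unconditionally_cauchy_cvg (@ell2_complete _ _) Tx).
exact: (unconditionally_cauchy_cvg (@ell2_complete _ _) Sx).
Qed.

Lemma weighted_shift_criterion_consequences :
  frequent_hypercyclicity_criterion T ->
  [/\ chaotic T, frequently_hypercyclic T & topologically_mixing T].
Proof.
move=> [X0 [S' [dX0 S'X0 X0P]]].
have [M M0 TM] := @shift_bounded _ _ 1 W T (weighted_shift_shiftE W_bounded) W_bounded.
apply: (criterion_consequences M0 TM (@ell2_complete _ _)
  (separable_ell2 e_basis P_proj) dX0 S'X0) => x /X0P[Tx Sx TSx].
by split=> //; exact: unconditionally_convergent_cauchy.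
Qed.


End WeightedShiftChaos.

Theorem theorem3p3 (R : realType) (H : hilbertType R) (e : int -> H)
    (P : nat -> bounded_op H) (W Winv : int -> bounded_op H)
    (e_basis : orthonormal_basis e)
    (P_proj : forall m, orthogonal_projection (basis_section e m) (P m))
    (W_invl : forall j, Winv j * W j = 1) (W_invr : forall j, W j * Winv j = 1)
    (W_bounded : uniformly_bounded W) (Winv_bounded : uniformly_bounded Winv) :
  let T := weighted_shift W_bounded in
  [<-> chaotic T;
       frequent_hypercyclicity_criterion T;
       forall J m : nat, (0 < J)%N -> (0 < m)%N ->
       exists (n : nat -> nat) (D : int -> nat -> bounded_op H),
         [/\ forall k, (0 < n k)%N,
             {homo n : k k' / (k < k')%N},
             forall (j : int) k, - J%:Z <= j <= J%:Z -> compact_op (D j k) &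
             forall j : int, - J%:Z <= j <= J%:Z ->
             [/\ rnorm (D j k - P m) @[k --> \oo] --> (0 : R),
                 forall k, cvg_in_B0
                   (\sum_(1 <= l < N.+1) forward_term W (D j k) j (l * n k)
                     @[N --> \oo]) &
                 forall k, cvg_in_B0
                   (\sum_(1 <= l < N.+1) backward_term Winv (D j k) j (l * n k)
                     @[N --> \oo])]]]
  /\ (chaotic T -> frequently_hypercyclic T /\ topologically_mixing T).
Proof.
move=> T.
have chaotic_cond : chaotic T -> series_condition P W Winv.
  by case=> _; exact: (dense_periodic_series_condition e_basis P_proj W_invl Winv_bounded).
have cond_fhc : series_condition P W Winv -> frequent_hypercyclicity_criterion T.
  exact: (series_condition_criterion e_basis P_proj W_invr W_bounded Winv_bounded).
have fhcP : frequent_hypercyclicity_criterion T ->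
    [/\ chaotic T, frequently_hypercyclic T & topologically_mixing T].
  exact: (weighted_shift_criterion_consequences e_basis P_proj).
split; first by tfae => [/chaotic_cond/cond_fhc|/fhcP[/chaotic_cond]|/cond_fhc/fhcP[]].
by move=> /chaotic_cond/cond_fhc/fhcP[].
Qed.
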